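(* Let $\xi(j)$, $j\in\mathbb Z$, be a zero mean wide sense stationary sequence with spectral density $f(\lambda)$ that admits the canonical factorization $$f(\lambda)=|\varphi(\lambda)|^2,\qquad \varphi(\lambda)=\sum_{k=0}^\infty d(k)e^{-ik\lambda},\qquad \sum_{k=0}^\infty|d(k)|^2<\infty .$$ Let $\sum_{j=0}^\infty|a(j)|<\infty$ and $\sum_{j=0}^\infty(j+1)|a(j)|^2<\infty$. (i) The mean-square error of the optimal linear estimate of $A\xi=\sum_{j=0}^\infty a(j)\xi(j)$ based on observations of $\xi(j)$, $j=-1,-2,\dots$, equals $$\Delta(h(f),f)=\min_{h\in L_2^-(f)}\Delta(h,f)=\|Ad\|^2=\sum_{k=0}^\infty|(Ad)_k|^2,\qquad (Ad)_k=\sum_{l=0}^\infty a(k+l)d(l),$$ and its spectral characteristic is $$h(f)=A(e^{i\lambda})-\varphi^{-1}(\lambda)\,r(e^{i\lambda}),\qquad A(e^{i\lambda})=\sum_{j=0}^\infty a(j)e^{ij\lambda},\quad r(e^{i\lambda})=\sum_{k=0}^\infty (Ad)_ke^{ik\lambda}.$$ (ii) For every $N\ge0$, the mean-square error of the optimal linear estimate of $A_N\xi=\sum_{j=0}^N a(j)\xi(j)$ based on the same observations equals $$\|A_Nd\|^2=\sum_{k=0}^N|(A_Nd)_k|^2,\qquad (A_Nd)_k=\sum_{l=0}^{N-k}a(k+l)d(l),$$ and its spectral characteristic is $$h_N(f)=A_N(e^{i\lambda})-\varphi^{-1}(\lambda)\,r_N(e^{i\lambda}),\qquad A_N(e^{i\lambda})=\sum_{j=0}^N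 a(j)e^{ij\lambda},\quad r_N(e^{i\lambda})=\sum_{k=0}^N(A_Nd)_ke^{ik\lambda}.$$
   Context: Spectral density convention: $E\xi(j+k)\overline{\xi(j)}=\frac1{2\pi}\int_{-\pi}^{\pi}e^{ik\lambda}f(\lambda)d\lambda$; $\xi(j)=\int_{-\pi}^\pi e^{ij\lambda}Z_\xi(d\lambda)$ with $Z_\xi$ an orthogonal random measure. $f$ satisfies the regularity condition $\int_{-\pi}^{\pi}\ln f(\lambda)d\lambda>-\infty$. The factorization is canonical when it corresponds to the canonical one-sided moving average representation $\xi(j)=\sum_{u=-\infty}^{j}d(j-u)\varepsilon(u)$, where $\varepsilon$ is white noise ($E\varepsilon(i)\overline{\varepsilon(j)}=\delta_{ij}$) and, for every $n$, the closed linear spans of $\{\xi(k):k\le n\}$ and $\{\varepsilon(k):k\le n\}$ coincide. $L_2(f)$ is the Hilbert space of functions square integrable with respect to $f(\lambda)d\lambda$, and $L_2^-(f)$ is its closed subspace generated by $\{e^{in\lambda}:n=-1,-2,\dots\}$. A linear estimate has the form $\int_{-\pi}^\pi h(e^{i\lambda})Z_\xi(d\lambda)$ with spectral characteristic $h\in L_2^-(f)$, and its mean-square error as an estimate of $A\xi$ is $\Delta(h,f)=\frac1{2\pi}\int_{-\pi}^\pi|A(e^{i\lambda})-h(e^{i\lambda})|^2f(\lambda)d\lambda$ (with $A_N$ in place of $A$ for $A_N\xi$). *)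

(* Defs.v *)
From HB Require Import structures.
From mathcomp Require Import all_boot all_order all_algebra.
From mathcomp Require Import complex.
From mathcomp Require Import all_classical all_reals all_analysis.
Import Order.TTheory GRing.Theory Num.Theory.
Import numFieldNormedType.Exports.

Set Implicit Arguments.
Unset Strict Implicit.
Unset Printing Implicit Defensive.

Local Open Scope classical_set_scope.
Local Open Scope ring_scope.
Local Open Scope complex_scope.

(* Random variables and functions on the circle take values in [R[i]].  A
   function of e^{i lambda} is represented as a function of lambda on
   [-pi, pi]; elements of L_2 spaces are functions, not classes. *)

Section Complex.
Context {R : realType}.
Implicit Types (z : R[i]) (u : nat -> R[i]).

(* |z|^2 and |z|, as elements of R *)
Definition sqmod z : R := complex.Re z ^+ 2 + complex.Im z ^+ 2.
Definition cmod z : R := Num.sqrt (sqmod z).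

Definition expi (x : R) : R[i] := cos x +i* sin x.

Definition csum u : R[i] :=
  limn (series (fun k => complex.Re (u k)))
  +i* limn (series (fun k => complex.Im (u k))).

Definition l2norm2 u : \bar R := (\sum_(0 <= k <oo) (sqmod (u k))%:E)%E.

End Complex.

(* The complex space L_2(D, w dmu). *)
Section L2.
Context {R : realType} {d : measure_display} {T : measurableType d}.
Variables (mu : {measure set T -> \bar R}) (D : set T).
Implicit Types (w : T -> R) (g h : T -> R[i]).

Definition cint g : R[i] :=
  (\int[mu]_(x in D) complex.Re (g x)) +i* (\int[mu]_(x in D) complex.Im (g x)).

Definition cmeasurable g : Prop :=
  measurable_fun D (fun x => complex.Re (g x)) /\
  measurable_fun D (fun x => complex.Im (g x)).

Definition sqdist w g h : \bar R :=
  (\int[mu]_(x in D) (sqmod (g x - h x) * w x)%:E)%E.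

Definition inL2 w g : Prop :=
  cmeasurable g /\ (\int[mu]_(x in D) (sqmod (g x) * w x)%:E < +oo)%E.

Definition L2_sum w (u : nat -> T -> R[i]) g : Prop :=
  inL2 w g /\
  (fun n => sqdist w g (fun x => \sum_(k < n) u k x)) @ \oo --> (0 : \bar R).

Definition closed_span w (u : int -> T -> R[i]) (J : pred int) g : Prop :=
  inL2 w g /\
  forall e : R, 0 < e ->
    exists (s : seq int) (c : int -> R[i]),
      all J s /\ (sqdist w g (fun x => (\sum_(k <- s) c k * u k x)%R) < e%:E)%E.

End L2.

Section Prediction.
Context {R : realType} {dT : measure_display} {T : measurableType dT}.
Variable P : probability T R.
Implicit Types (X Y zeta : T -> R[i]) (xi eps : int -> T -> R[i]).
Implicit Types (f : R -> R) (A g h phi : R -> R[i]) (Z : set R -> T -> R[i]).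

Local Notation leb := (@lebesgue_measure R).

Definition circle : set R := `[- pi, pi]%classic.

Definition E X : R[i] := cint P setT X.
Definition randomL2 X : Prop := inL2 P setT (cst 1) X.
Definition mse X Y : \bar R := sqdist P setT (cst 1) X Y.
Definition ms_sum (u : nat -> T -> R[i]) X : Prop :=
  L2_sum P setT (cst 1) u X.
Definition random_span xi (n : int) X : Prop :=
  closed_span P setT (cst 1) xi (fun k => k <= n) X.

Definition zero_mean_wide_sense_stationary xi : Prop :=
  [/\ forall j, randomL2 (xi j),
      forall j, E (xi j) = 0 &
      forall j k, E (fun t => xi (j + k) t * conjc (xi j t))
                  = E (fun t => xi k t * conjc (xi 0 t))].

Definition spectral_density xi f : Prop :=
  [/\ measurable_fun circle f,
      forall x, circle x -> 0 <= f x,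
      (\int[leb]_(x in circle) (f x)%:E < +oo)%E &
      forall j k : int,
        E (fun t => xi (j + k) t * conjc (xi j t))
        = ((2 * pi)^-1)%:C *
          cint leb circle (fun x => expi (k%:~R * x) * (f x)%:C)].

(* [lne] is used because [ln 0 = 0], whereas [lne 0 = -oo]. *)
Definition regular f : Prop :=
  (-oo < \int[leb]_(x in circle) lne (f x)%:E)%E.

Definition borel_of_circle (B : set R) : Prop :=
  measurable B /\ B `<=` circle.

(* Orthogonal random measure with structure measure f(lambda) dlambda / 2pi. *)
Definition orthogonal_random_measure f Z : Prop :=
  [/\ forall B, borel_of_circle B -> randomL2 (Z B),
      forall B C, borel_of_circle B -> borel_of_circle C -> B `&` C = set0 ->
        {ae P, forall t, Z (B `|` C) t = Z B t + Z C t} &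
      forall B C, borel_of_circle B -> borel_of_circle C ->
        E (fun t => Z B t * conjc (Z C t))
        = ((2 * pi)^-1 * \int[leb]_(x in B `&` C) f x)%:C].

Definition inL2f f h : Prop := inL2 leb circle f h.

(* X = int h(lambda) Z(dlambda): the integral of a step function is the
   corresponding finite sum, extended to L_2(f) by mean-square limits. *)
Definition stochastic_integral f Z h X : Prop :=
  [/\ inL2f f h, randomL2 X &
      exists (m : nat -> nat) (c : nat -> nat -> R[i]) (B : nat -> nat -> set R),
        [/\ forall n i, borel_of_circle (B n i),
            (fun n => sqdist leb circle f h
               (fun x => \sum_(i < m n) c n i * (\1_(B n i) x)%:C))
              @ \oo --> (0 : \bar R) &
            (fun n => mse X (fun t => \sum_(i < m n) c n i * Z (B n i) t))
              @ \oo --> (0 : \bar R)]].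

Definition spectral_representation f Z xi : Prop :=
  orthogonal_random_measure f Z /\
  forall j : int, stochastic_integral f Z (fun x => expi (j%:~R * x)) (xi j).

Definition white_noise eps : Prop :=
  (forall i, randomL2 (eps i)) /\
  forall i j, E (fun t => eps i t * conjc (eps j t)) = (i == j)%:R.

(* xi(j) = sum_{u <= j} d(j - u) eps(u), indexed by k = j - u. *)
Definition canonical_moving_average xi (d : nat -> R[i]) : Prop :=
  exists eps, [/\ white_noise eps,
    forall j : int, ms_sum (fun k t => d k * eps (j - k%:Z) t) (xi j) &
    forall n X, random_span xi n X <-> random_span eps n X].

(* phi is a version of the L_2(dlambda)-sum of the series. *)
Definition canonical_factorization xi f (d : nat -> R[i]) phi : Prop :=
  [/\ (l2norm2 d < +oo)%E,
      L2_sum leb circle (cst 1) (fun k x => d k * expi (- (k%:R * x))) phi,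
      {ae leb, forall x, circle x -> f x = sqmod (phi x)} &
      canonical_moving_average xi d].

Definition L2minus f h : Prop :=
  closed_span leb circle f (fun n x => expi (n%:~R * x)) (fun n => n < 0) h.

Definition Delta A h f : \bar R :=
  (((2 * pi)^-1)%:E * sqdist leb circle f A h)%E.

Definition spectral_characteristic f Z zeta h : Prop :=
  L2minus f h /\ stochastic_integral f Z h zeta.

Definition linear_estimate f Z zeta : Prop :=
  exists h, spectral_characteristic f Z zeta h.

Definition optimal_linear_estimate f Z X zeta : Prop :=
  linear_estimate f Z zeta /\
  forall zeta', linear_estimate f Z zeta' -> (mse X zeta <= mse X zeta')%E.

(* The problem of estimating X, a functional with spectral transform A, has
   optimal error e and optimal spectral characteristic h (unique in L_2(f)). *)
Definition optimal_error_and_characteristic f Z X A (e : \bar R) h : Prop :=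
  [/\ L2minus f h,
      Delta A h f = e,
      forall g, L2minus f g -> (e <= Delta A g f)%E,
      exists zeta, optimal_linear_estimate f Z X zeta &
      forall zeta, optimal_linear_estimate f Z X zeta ->
        [/\ mse X zeta = e,
            spectral_characteristic f Z zeta h &
            forall g, spectral_characteristic f Z zeta g ->
              sqdist leb circle f g h = 0%E]].

Definition Afun (a : nat -> R[i]) (x : R) : R[i] :=
  csum (fun j => a j * expi (j%:R * x)).
Definition Ad (a d : nat -> R[i]) (k : nat) : R[i] :=
  csum (fun l => a (k + l)%N * d l).
Definition is_rfun (a d : nat -> R[i]) (r : R -> R[i]) : Prop :=
  L2_sum leb circle (cst 1) (fun k x => Ad a d k * expi (k%:R * x)) r.

Definition AfunN (N : nat) (a : nat -> R[i]) (x : R) : R[i] :=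
  \sum_(j < N.+1) a j * expi (j%:R * x).
Definition AdN (N : nat) (a d : nat -> R[i]) (k : nat) : R[i] :=
  \sum_(l < (N - k).+1) a (k + l)%N * d l.
Definition rfunN (N : nat) (a d : nat -> R[i]) (x : R) : R[i] :=
  \sum_(k < N.+1) AdN N a d k * expi (k%:R * x).
Definition AxiN (N : nat) (a : nat -> R[i]) xi (t : T) : R[i] :=
  \sum_(j < N.+1) a j * xi j%:Z t.

End Prediction.

(* Main.v *)
(**
Multiplication by phi maps L_2(f) isometrically into L_2(dlambda / 2pi), because
f = |phi|^2 almost everywhere; the spectral representation identifies the
stochastic integral of h with phi h.  Let p_k = phi e^{ik lambda}.  Expanding phi
shows that p_k is a combination of e^{im lambda}, m <= k.  Conversely the map
eps(m) |-> e^{im lambda} is isometric and sends xi(k) to p_k, so canonicity of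
the moving average puts e^{im lambda} in the closed span of p_k, k <= m.  Hence
phi L_2^-(f) has the same closure as the span of e^{im lambda}, m < 0, and the
best approximation of phi A from it is phi A - r, where r is the orthogonal
projection of phi A on the span of e^{ik lambda}, k >= 0.  The Fourier
coefficients of r are (Ad)_k, and phi h = phi A - r determines h since phi is
nonzero almost everywhere by regularity.
*)
Require Import Defs.
From HB Require Import structures.
From mathcomp Require Import all_boot all_order all_algebra.
From mathcomp Require Import complex.
From mathcomp Require Import all_classical all_reals all_analysis.
From mathcomp Require Import measurable_realfun.
From mathcomp Require Import ring lra zify.
Import Order.TTheory GRing.Theory Num.Theory.
Import numFieldNormedType.Exports.
Set Implicit Arguments.
Unset Strict Implicit.
Unset Printing Implicit Defensive.
Local Open Scope classical_set_scope.
Local Open Scope ring_scope.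
Local Open Scope complex_scope.

(** The isometries between random variables and functions on the circle are never built as maps.
    Elements of the L_2 spaces are functions, so such a map would be determined only up to null
    sets; instead each isometry is its closed graph, a closed hull of pairs in the direct sum of two
    semi-inner product spaces. Equality of Gram matrices on the generating pairs forces both
    coordinates of the pairs in the hull to have the same inner products. This one device serves the
    pairs of Z(B) and phi 1_B (stochastic integral), of eps(m) and e^{im lambda} (canonicity), and
    of xi(k) and p_k (existence of integrals and functionals). The geometry of the projection is
    proved in an arbitrary semi-inner product space from three facts about the two systems:
    orthonormality, the causal expansion of p_k, and the innovation property. The minimum is
    Pythagoras; completeness of L_2 serves existence only: of r, of the functional A xi, and of an
    estimate with a prescribed spectral characteristic. *)

Section ComplexFacts.
Context {R : realType}.
Implicit Types z w : R[i].

Lemma sqmod_ge0 z : 0 <= sqmod z.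
Proof. by rewrite /sqmod addr_ge0 ?sqr_ge0. Qed.

Lemma sqmod0 : sqmod (0 : R[i]) = 0.
Proof. by rewrite /sqmod /= expr0n addr0. Qed.

Lemma sqmod_eq0 z : sqmod z = 0 -> z = 0.
Proof.
case: z => x y; rewrite /sqmod /= => /eqP.
by rewrite paddr_eq0 ?sqr_ge0 // !sqrf_eq0 => /andP[/eqP-> /eqP->].
Qed.

Lemma sqmodM z w : sqmod (z * w) = sqmod z * sqmod w.
Proof. by case: z w => [a b] [c d]; rewrite /sqmod /=; ring. Qed.

Lemma sqmodN z : sqmod (- z) = sqmod z.
Proof. by case: z => a b; rewrite /sqmod /= !sqrrN. Qed.

Lemma mulcJ z : z * conjc z = (sqmod z)%:C.
Proof. by case: z => a b; rewrite /sqmod /=; simpc; congr (_ +i* _); ring. Qed.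

Lemma conjcM z w : conjc (z * w) = conjc z * conjc w.
Proof. by case: z w => [a b] [c d]; simpc; congr (_ +i* _); ring. Qed.

Lemma conjcr (x : R) : conjc x%:C = x%:C.
Proof. by rewrite /real_complex_def /= oppr0. Qed.

Lemma sqmodD_le z w : sqmod (z + w) <= 2 * sqmod z + 2 * sqmod w.
Proof.
case: z w => [a b] [c d]; rewrite /sqmod /=.
have := sqr_ge0 (a - c); have := sqr_ge0 (b - d); nra.
Qed.

(** The absolute value on the right is the shape in which [le_integrable] takes a dominating
    function; the bound makes products of square integrable functions integrable. *)
Lemma normRe_mulJ z w : `|complex.Re (z * conjc w)| <= `|sqmod z + sqmod w|.
Proof.
rewrite [leRHS]ger0_norm; last by rewrite addr_ge0 // sqmod_ge0.
case: z w => [a b] [c d]; rewrite /sqmod /= ler_norml.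
have := sqr_ge0 (a - c); have := sqr_ge0 (a + c).
have := sqr_ge0 (b - d); have := sqr_ge0 (b + d).
by move=> ? ? ? ?; apply/andP; split; nra.
Qed.

Lemma normIm_mulJ z w : `|complex.Im (z * conjc w)| <= `|sqmod z + sqmod w|.
Proof.
rewrite [leRHS]ger0_norm; last by rewrite addr_ge0 // sqmod_ge0.
case: z w => [a b] [c d]; rewrite /sqmod /= ler_norml.
have := sqr_ge0 (a - d); have := sqr_ge0 (a + d).
have := sqr_ge0 (b - c); have := sqr_ge0 (b + c).
by move=> ? ? ? ?; apply/andP; split; nra.
Qed.

Lemma cReD z w : complex.Re (z + w) = complex.Re z + complex.Re w.
Proof. by case: z w => [a b] [c d]. Qed.

Lemma cImD z w : complex.Im (z + w) = complex.Im z + complex.Im w.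
Proof. by case: z w => [a b] [c d]. Qed.

Lemma cReN z : complex.Re (- z) = - complex.Re z.
Proof. by case: z. Qed.

Lemma cImN z : complex.Im (- z) = - complex.Im z.
Proof. by case: z. Qed.

Lemma cReMr z (r : R) : complex.Re (r%:C * z) = r * complex.Re z.
Proof. by case: z => a b /=; ring. Qed.

Lemma cReJ z : complex.Re (conjc z) = complex.Re z.
Proof. by case: z. Qed.

Lemma cRe_sum (I : Type) (l : seq I) (F : I -> R[i]) :
  complex.Re (\sum_(i <- l) F i) = \sum_(i <- l) complex.Re (F i).
Proof. exact: (big_morph _ cReD). Qed.

Lemma cIm_sum (I : Type) (l : seq I) (F : I -> R[i]) :
  complex.Im (\sum_(i <- l) F i) = \sum_(i <- l) complex.Im (F i).
Proof. exact: (big_morph _ cImD). Qed.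

End ComplexFacts.

(** * Semi-inner product spaces and closed linear hulls *)

(* Only semi-definite: elements of the L_2 spaces below are functions, not classes. *)
Record sip (R : realType) (V : lmodType R[i]) := Sip {
  ip :> V -> V -> R[i];
  ipDl : forall x y z, ip (x + y) z = ip x z + ip y z;
  ipZl : forall c x z, ip (c *: x) z = c * ip x z;
  ipC : forall x y, ip x y = conjc (ip y x);
  ip_ge0 : forall x, 0 <= complex.Re (ip x x) }.

Definition nrm2 (R : realType) (V : lmodType R[i]) (S : sip V) (x : V) : R :=
  complex.Re (S x x).

(** Indices may repeat in the list, so that adding two combinations is concatenation. *)
Definition lincomb (R : realType) (V : lmodType R[i]) (I : Type) (u : I -> V)
  (l : seq (R[i] * I)) : V := \sum_(p <- l) p.1 *: u p.2.

(** The closed linear span, described by approximation alone. It contains every vector at seminorm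
    distance zero from a member, which absorbs modifications on null sets. *)
Definition chull (R : realType) (V : lmodType R[i]) (S : sip V) (I : Type)
    (u : I -> V) (J : set I) (x : V) : Prop :=
  forall e : R, 0 < e -> exists l : seq (R[i] * I),
    all (fun p => p.2 \in J) l /\ nrm2 S (x - lincomb u l) < e.

Section SemiInnerProduct.
Context {R : realType} {V : lmodType R[i]} (S : sip V).
Implicit Types (x y z : V) (c : R[i]).

Lemma ipDr x y z : S x (y + z) = S x y + S x z.
Proof. by rewrite ipC ipDl rmorphD /= -!ipC. Qed.

Lemma ipZr c x y : S x (c *: y) = conjc c * S x y.
Proof. by rewrite ipC ipZl rmorphM /= -ipC. Qed.

Lemma ip0l x : S 0 x = 0.
Proof. by rewrite -(scale0r (0 : V)) ipZl mul0r. Qed.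

Lemma ipNl x y : S (- x) y = - S x y.
Proof. by rewrite -scaleN1r ipZl mulN1r. Qed.

Lemma ip0r x : S x 0 = 0.
Proof. by rewrite ipC ip0l conjc0. Qed.

Lemma ipNr x y : S x (- y) = - S x y.
Proof. by rewrite ipC ipNl rmorphN /= -ipC. Qed.

Lemma ipBl x y z : S (x - y) z = S x z - S y z.
Proof. by rewrite ipDl ipNl. Qed.

Lemma ipBr x y z : S z (x - y) = S z x - S z y.
Proof. by rewrite ipDr ipNr. Qed.

Lemma ip_suml (I : Type) (l : seq I) (P : pred I) (F : I -> V) y :
  S (\sum_(i <- l | P i) F i) y = \sum_(i <- l | P i) S (F i) y.
Proof. exact: (big_morph (fun x => S x y) (fun a b => ipDl S a b y) (ip0l y)). Qed.

Lemma ip_sumr (I : Type) (l : seq I) (P : pred I) (F : I -> V) y :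
  S y (\sum_(i <- l | P i) F i) = \sum_(i <- l | P i) S y (F i).
Proof. exact: (big_morph (fun x => S y x) (fun a b => ipDr y a b) (ip0r y)). Qed.

Lemma nrm2_ge0 x : 0 <= nrm2 S x.
Proof. exact: ip_ge0. Qed.

Lemma nrm20 : nrm2 S 0 = 0.
Proof. by rewrite /nrm2 ip0l. Qed.

Lemma nrm2N x : nrm2 S (- x) = nrm2 S x.
Proof. by rewrite /nrm2 ipNl ipNr opprK. Qed.

Lemma nrm2_subC x y : nrm2 S (x - y) = nrm2 S (y - x).
Proof. by rewrite -opprB nrm2N. Qed.

Lemma nrm2Z c x : nrm2 S (c *: x) = sqmod c * nrm2 S x.
Proof. by rewrite /nrm2 ipZl ipZr mulrA mulcJ cReMr. Qed.

Lemma nrm2D x y :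
  nrm2 S (x + y) = nrm2 S x + nrm2 S y + 2 * complex.Re (S x y).
Proof.
rewrite /nrm2 ipDl !ipDr !cReD (ipC S y x) cReJ; ring.
Qed.

Lemma nrm2_orthoD x y : S x y = 0 -> nrm2 S (x + y) = nrm2 S x + nrm2 S y.
Proof. by move=> xy0; rewrite nrm2D xy0 /= mulr0 addr0. Qed.

(** Half of the parallelogram law. It replaces the triangle inequality, so that no square roots
    occur; its factors 2 are the reason for the tolerances [e / 4]. *)
Lemma nrm2D_le x y : nrm2 S (x + y) <= 2 * nrm2 S x + 2 * nrm2 S y.
Proof.
have := nrm2_ge0 (x - y); rewrite !nrm2D ipNr cReN nrm2N; lra.
Qed.

Lemma nrm2_tri z x y : nrm2 S (x - y) <= 2 * nrm2 S (x - z) + 2 * nrm2 S (z - y).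
Proof. by have := nrm2D_le (x - z) (z - y); rewrite addrA subrK. Qed.

Lemma cauchy_schwarz x y : sqmod (S x y) <= nrm2 S x * nrm2 S y.
Proof.
(* This is the squared seminorm of x - t <x,y> y for real [t]. The choice [t = (nrm2 S y)^-1] gives
   the inequality unless [nrm2 S y] is zero. *)
have quad t : 0 <= nrm2 S x - 2 * t * sqmod (S x y)
                   + t ^+ 2 * sqmod (S x y) * nrm2 S y.
  have := nrm2_ge0 (x + (- (t%:C * S x y)) *: y).
  rewrite nrm2D nrm2Z ipZr; move: (nrm2 S x) (nrm2 S y) (S x y) => X Y [a b].
  rewrite /sqmod /= => H; apply: (le_trans H); rewrite le_eqVlt; apply/orP; left.
  by apply/eqP; ring.
have [N0|N0] := eqVneq (nrm2 S y) 0; last first.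
  have Np : 0 < nrm2 S y by rewrite lt_neqAle eq_sym N0 nrm2_ge0.
  have := quad (nrm2 S y)^-1.
  rewrite expr2 -!mulrA (mulrC (sqmod _) (nrm2 S y)) (mulKf N0).
  by rewrite -ler_pdivrMr // (mulrC _ (_^-1)) => H; lra.
(* For a null vector [y] the quadratic in [t] is affine; if the inner product were nonzero, the
   value of [t] chosen next would make it -1. *)
rewrite N0 mulr0 leNgt; apply/negP => sp.
have := quad ((nrm2 S x + 1) / (2 * sqmod (S x y))); rewrite N0 mulr0 addr0.
have -> : 2 * ((nrm2 S x + 1) / (2 * sqmod (S x y))) * sqmod (S x y)
   = nrm2 S x + 1 by field; rewrite gt_eqF.
lra.
Qed.

(** Stands in for definiteness: null vectors are invisible to the inner product. *)
Lemma nrm2_eq0_ip x y : nrm2 S x = 0 -> S x y = 0.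
Proof.
move=> x0; apply/sqmod_eq0/le_anti; rewrite sqmod_ge0 andbT.
by rewrite (le_trans (cauchy_schwarz x y)) // x0 mul0r.
Qed.

Lemma nrm2D0 x y : nrm2 S y = 0 -> nrm2 S (x + y) = nrm2 S x.
Proof. by move=> y0; rewrite addrC nrm2D y0 nrm2_eq0_ip //= mulr0 addr0 add0r. Qed.

Section Hull.
Variables (I : Type) (u : I -> V) (J : set I).

Lemma lincomb_cat l l' : lincomb u (l ++ l') = lincomb u l + lincomb u l'.
Proof. by rewrite /lincomb big_cat. Qed.

Lemma chull_lim x :
  (forall e : R, 0 < e -> exists2 y, chull S u J y & nrm2 S (x - y) < e) ->
  chull S u J x.
Proof.
move=> H e e0; have e4 : 0 < e / 4 by lra.
have [y /(_ _ e4)[l [Jl yl]] xy] := H _ e4.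
exists l; split=> //; have := nrm2_tri y x (lincomb u l); lra.
Qed.

Lemma chull_gen i : J i -> chull S u J (u i).
Proof.
move=> Ji e e0; exists [:: (1, i)]; split; first by rewrite /= andbT; apply/mem_set.
by rewrite /lincomb big_seq1 scale1r subrr nrm20.
Qed.

Lemma chull0 : chull S u J 0.
Proof. by move=> e e0; exists [::]; rewrite /lincomb big_nil subrr nrm20. Qed.

Lemma chullD x y : chull S u J x -> chull S u J y -> chull S u J (x + y).
Proof.
move=> Hx Hy e e0; have e4 : 0 < e / 4 by lra.
have [l [Jl xl]] := Hx _ e4; have [l' [Jl' yl']] := Hy _ e4.
exists (l ++ l'); split; first by rewrite all_cat Jl.
by rewrite lincomb_cat opprD addrACA; have := nrm2D_le (x - lincomb u l) (y - lincomb u l'); lra.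
Qed.

Lemma chullZ c x : chull S u J x -> chull S u J (c *: x).
Proof.
(* Adding 1 keeps the denominator positive when [c] is zero. *)
move=> Hx e e0; have e4 : 0 < e / (sqmod c + 1).
  by rewrite divr_gt0 // ltr_wpDl ?sqmod_ge0.
have [l [Jl xl]] := Hx _ e4.
exists [seq (c * p.1, p.2) | p <- l]; split; first by rewrite all_map.
have -> : lincomb u [seq (c * p.1, p.2) | p <- l] = c *: lincomb u l.
  by rewrite /lincomb big_map scaler_sumr; apply: eq_bigr => p _; rewrite scalerA.
rewrite -scalerBr nrm2Z; move: xl; rewrite ltr_pdivlMr; last first.
  by rewrite ltr_wpDl ?sqmod_ge0.
by have := nrm2_ge0 (x - lincomb u l); have := sqmod_ge0 c; nra.
Qed.

Lemma chullB x y : chull S u J x -> chull S u J y -> chull S u J (x - y).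
Proof. by move=> Hx Hy; rewrite -scaleN1r; apply: chullD => //; exact: chullZ. Qed.

Lemma chull_sum (K : Type) (l : seq K) (P : pred K) (F : K -> V) :
  (forall k, P k -> chull S u J (F k)) -> chull S u J (\sum_(k <- l | P k) F k).
Proof. move=> H; apply: big_ind => //; [exact: chull0|exact: chullD]. Qed.

Lemma chull_lincomb l : all (fun p => p.2 \in J) l -> chull S u J (lincomb u l).
Proof.
elim: l => [_|p l IH /= /andP[Jp Jl]]; first by rewrite /lincomb big_nil; exact: chull0.
rewrite /lincomb big_cons; apply: chullD; last exact: IH.
by apply/chullZ/chull_gen/set_mem.
Qed.

(** A bounded linear functional is continuous, so vanishing passes from the generators to the closed
    hull. With an inner product as [B] this gives orthogonality to a hull; with a difference of
    inner products on a product space it gives isometries. *)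
Lemma chull_form0 (B : V -> R[i]) (C : R) :
  (forall x y, B (x + y) = B x + B y) -> (forall c x, B (c *: x) = c * B x) ->
  (forall x, sqmod (B x) <= C * nrm2 S x) ->
  (forall i, J i -> B (u i) = 0) ->
  forall x, chull S u J x -> B x = 0.
Proof.
move=> BD BZ Bb Bu x Hx; apply: sqmod_eq0; apply/eqP.
rewrite eq_le sqmod_ge0 andbT; apply/ler_addgt0Pr => e e0; rewrite add0r.
have e1 : 0 < e / (`|C| + 1) by rewrite divr_gt0 // ltr_wpDl.
have [l [Jl xl]] := Hx _ e1.
have B0 : B 0 = 0 by rewrite -(scale0r (0 : V)) BZ mul0r.
have Bl : B (lincomb u l) = 0.
  elim: l Jl {xl} => [_|p l IH /= /andP[Jp Jl]]; first by rewrite /lincomb big_nil.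
  rewrite /lincomb big_cons BD BZ Bu ?mulr0 ?add0r; first exact: IH.
  exact: set_mem.
have -> : B x = B (x - lincomb u l) by rewrite BD -scaleN1r BZ Bl mulr0 addr0.
apply: (le_trans (Bb _)); move: xl; rewrite ltr_pdivlMr; last by rewrite ltr_wpDl.
have := nrm2_ge0 (x - lincomb u l); have := ler_norm C; have := normr_ge0 C; nra.
Qed.

Lemma chull_ortho y : (forall i, J i -> S (u i) y = 0) ->
  forall x, chull S u J x -> S x y = 0.
Proof.
move=> uy; apply: (@chull_form0 (fun x => S x y) (nrm2 S y)) => //.
- by move=> *; exact: ipDl.
- by move=> *; exact: ipZl.
- by move=> x; rewrite mulrC; exact: cauchy_schwarz.
Qed.

End Hull.

Lemma chull_trans (I I' : Type) (u : I -> V) (J : set I) (u' : I' -> V) (J' : set I') :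
  (forall i, J i -> chull S u' J' (u i)) ->
  forall x, chull S u J x -> chull S u' J' x.
Proof.
move=> H x Hx; apply: chull_lim => e e0; have [l [Jl xl]] := Hx _ e0.
exists (lincomb u l) => //; elim: l Jl {xl} => [_|p l IH /= /andP[Jp Jl]].
  by rewrite /lincomb big_nil; exact: chull0.
rewrite /lincomb big_cons; apply: chullD; last exact: IH.
by apply/chullZ/H/set_mem.
Qed.

End SemiInnerProduct.

(** * Isometries as closed graphs in a direct sum *)

Section ProductSpace.
Context {R : realType} {V W : lmodType R[i]} (S : sip V) (S' : sip W).

Definition pair_ip (p q : V * W) : R[i] := S p.1 q.1 + S' p.2 q.2.

Lemma pair_ipDl x y z : pair_ip (x + y) z = pair_ip x z + pair_ip y z.
Proof. by rewrite /pair_ip /= !ipDl addrACA. Qed.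

Lemma pair_ipZl c x z : pair_ip (c *: x) z = c * pair_ip x z.
Proof. by rewrite /pair_ip /= !ipZl mulrDr. Qed.

Lemma pair_ipC x y : pair_ip x y = conjc (pair_ip y x).
Proof. by rewrite /pair_ip rmorphD /= -!ipC. Qed.

Lemma pair_ip_ge0 x : 0 <= complex.Re (pair_ip x x).
Proof. by rewrite /pair_ip cReD addr_ge0 ?ip_ge0. Qed.

Definition pair_sip : sip (V * W)%type :=
  Sip pair_ipDl pair_ipZl pair_ipC pair_ip_ge0.

Lemma nrm2_pair p : nrm2 pair_sip p = nrm2 S p.1 + nrm2 S' p.2.
Proof. by rewrite /nrm2 /= /pair_ip cReD. Qed.

Lemma lincomb_fst (I : Type) (u : I -> V) (u' : I -> W) l :
  (lincomb (fun i => (u i, u' i)) l).1 = lincomb u l.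
Proof.
rewrite /lincomb; elim: l => [|p l IH]; first by rewrite !big_nil.
by rewrite !big_cons /= IH.
Qed.

Lemma lincomb_snd (I : Type) (u : I -> V) (u' : I -> W) l :
  (lincomb (fun i => (u i, u' i)) l).2 = lincomb u' l.
Proof.
rewrite /lincomb; elim: l => [|p l IH]; first by rewrite !big_nil.
by rewrite !big_cons /= IH.
Qed.

Section Isometry.
Variables (I : Type) (u : I -> V) (u' : I -> W) (J : set I).
Hypothesis gram : forall i j, J i -> J j -> S (u i) (u j) = S' (u' i) (u' j).

Let form_vanish (v : V) (v' : W) :
  (forall i, J i -> S (u i) v = S' (u' i) v') ->
  forall p, chull pair_sip (fun i => (u i, u' i)) J p -> S p.1 v = S' p.2 v'.
Proof.
move=> uv p Hp; apply/subr0_eq.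
apply: (@chull_form0 _ _ pair_sip _ _ _ (fun p => S p.1 v - S' p.2 v')
   (2 * (nrm2 S v + nrm2 S' v')) _ _ _ _ _ Hp).
- by move=> x y; by rewrite /= !ipDl; ring.
- by move=> c x; by rewrite /= !ipZl; ring.
(* The constant comes from [sqmodD_le] followed by Cauchy-Schwarz in each of the two spaces. *)
- move=> x; rewrite nrm2_pair; apply: (le_trans (sqmodD_le _ _)); rewrite sqmodN.
  have := cauchy_schwarz S x.1 v; have := cauchy_schwarz S' x.2 v'.
  have := nrm2_ge0 S x.1; have := nrm2_ge0 S v.
  have := nrm2_ge0 S' x.2; have := nrm2_ge0 S' v'; nra.
- by move=> i Ji /=; rewrite uv // subrr.
Qed.

(** Equality of inner products is extended from the generators to the hull one argument at a time,
    conjugate symmetry exchanging the two slots. *)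
Lemma chull_pair_iso p q :
  chull pair_sip (fun i => (u i, u' i)) J p ->
  chull pair_sip (fun i => (u i, u' i)) J q -> S p.1 q.1 = S' p.2 q.2.
Proof.
move=> Hp Hq; rewrite ipC [RHS]ipC; congr (conjc _).
move: q Hq; apply: form_vanish => i Ji.
rewrite ipC [RHS]ipC; congr (conjc _); move: p Hp; apply: form_vanish => j Jj.
exact: gram.
Qed.

Lemma chull_pair_nrm2 p :
  chull pair_sip (fun i => (u i, u' i)) J p -> nrm2 S p.1 = nrm2 S' p.2.
Proof. by move=> Hp; rewrite /nrm2 (chull_pair_iso Hp Hp). Qed.

End Isometry.
End ProductSpace.

(** * Convergence and completeness in the seminorm *)

Definition cvgH (R : realType) (V : lmodType R[i]) (S : sip V) (u : nat -> V)
    (x : V) : Prop :=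
  forall e : R, 0 < e -> exists N, forall n, (N <= n)%N -> nrm2 S (x - u n) < e.

Definition cauchyH (R : realType) (V : lmodType R[i]) (S : sip V)
    (u : nat -> V) : Prop :=
  forall e : R, 0 < e -> exists N, forall m n, (N <= m)%N -> (N <= n)%N ->
    nrm2 S (u m - u n) < e.

Definition completeH (R : realType) (V : lmodType R[i]) (S : sip V) : Prop :=
  forall u, cauchyH S u -> exists x, cvgH S u x.

Section Limits.
Context {R : realType} {V : lmodType R[i]} (S : sip V).
Implicit Types (u : nat -> V) (x y : V).

Lemma cvgH_chull (I : Type) (v : I -> V) (J : set I) u x :
  cvgH S u x -> (forall n, chull S v J (u n)) -> chull S v J x.
Proof.
move=> ux Hu; apply: chull_lim => e /ux[N]/(_ _ (leqnn N)) xN.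
by exists (u N).
Qed.

Lemma cvgH_cauchy u x : cvgH S u x -> cauchyH S u.
Proof.
move=> ux e e0; have [|N HN] := ux (e / 4); first by lra.
exists N => m n /HN mN /HN nN; have := nrm2_tri S x (u m) (u n).
rewrite (nrm2_subC S (u m) x); lra.
Qed.

Lemma cvgH_ip u x y (e : R) : cvgH S u x -> 0 < e ->
  exists N, forall n, (N <= n)%N -> sqmod (S x y - S (u n) y) < e.
Proof.
move=> ux e0; have e1 : 0 < e / (nrm2 S y + 1).
  by rewrite divr_gt0 // ltr_wpDl ?nrm2_ge0.
have [N HN] := ux _ e1; exists N => n /HN.
rewrite -ipBl ltr_pdivlMr ?ltr_wpDl ?nrm2_ge0 // => H.
apply: (le_lt_trans (cauchy_schwarz _ _ _)).
by have := nrm2_ge0 S (x - u n); have := nrm2_ge0 S y; nra.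
Qed.

(** Suited to orthonormal expansions: the inner product of the partial sums with a fixed basis
    vector no longer changes once the term of that vector is included. *)
Lemma cvgH_ip_const u x y c : cvgH S u x ->
  (exists N, forall n, (N <= n)%N -> S (u n) y = c) -> S x y = c.
Proof.
move=> ux [M HM]; apply/subr0_eq/sqmod_eq0/eqP.
rewrite eq_le sqmod_ge0 andbT; apply/ler_addgt0Pr => e e0; rewrite add0r.
have [N HN] := cvgH_ip y ux e0.
by have := HN (maxn M N) (leq_maxr _ _); rewrite HM ?leq_maxl // => /ltW.
Qed.

End Limits.

(** * Orthonormal systems *)

Section Orthonormal.
Context {R : realType} {V : lmodType R[i]} (S : sip V).

(** Deleting the terms with index outside [J] from an approximating combination can only decrease
    the error, because the deleted part is orthogonal to [v] minus the kept part. No infinite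
    expansion of [v] is needed. *)
Lemma chull_ortho_compl (I : eqType) (e : I -> V) (J : set I) v :
  (forall i j, S (e i) (e j) = (i == j)%:R) ->
  chull S e setT v -> (forall k, ~ J k -> S v (e k) = 0) -> chull S e J v.
Proof.
move=> eo Hv vJ r r0; have [l [_ xl]] := Hv _ r0.
pose l1 := [seq p <- l | p.2 \in J]; pose l2 := [seq p <- l | p.2 \notin J].
exists l1; split; first exact: filter_all.
have El : lincomb e l = lincomb e l1 + lincomb e l2.
  rewrite /lincomb !big_filter.
  by rewrite (bigID (fun p => p.2 \in J)).
have l2J : forall p, p \in l2 -> ~ J p.2.
  by move=> p; rewrite mem_filter => /andP[/negP pJ _] Jp; apply: pJ; apply/mem_set.
have o : S (v - lincomb e l1) (lincomb e l2) = 0.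
  rewrite {2}/lincomb big_seq ip_sumr big1 // => p /l2J pJ.
  rewrite ipZr ipBl vJ // /lincomb big_seq ip_suml big1 ?subr0 ?mulr0 // => q.
  rewrite mem_filter => /andP[/set_mem qJ _]; rewrite ipZl eo.
  by case: eqP => [qp|]; rewrite ?mulr0 //; exfalso; apply: pJ; rewrite -qp.
move: xl; rewrite El opprD addrA.
have -> := @nrm2_orthoD _ _ S (v - lincomb e l1) (- lincomb e l2).
  by rewrite nrm2N; have := nrm2_ge0 S (lincomb e l2); lra.
by rewrite ipNr o oppr0.
Qed.

Lemma nrm2_sum_ortho (e : nat -> V) (c : nat -> R[i]) m n :
  (forall i j, S (e i) (e j) = (i == j)%:R) ->
  nrm2 S (\sum_(m <= k < n) c k *: e k) = \sum_(m <= k < n) sqmod (c k).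
Proof.
move=> eo; rewrite /nrm2 ip_suml cRe_sum; apply: eq_big_nat => i ilt.
rewrite ip_sumr (bigD1_seq i) ?mem_index_iota ?iota_uniq //=.
rewrite ipZl ipZr eo eqxx mulr1 mulcJ big1 ?addr0 // => j ji.
by rewrite ipZl ipZr eo eq_sym (negbTE ji) !mulr0.
Qed.

(** Bessel's identity. It bounds the sums of squared coefficients, hence the existence of the
    projection, and yields Parseval once the remainder tends to zero. *)
Lemma nrm2_sub_proj (e : nat -> V) x n :
  (forall i j, S (e i) (e j) = (i == j)%:R) ->
  nrm2 S x = \sum_(0 <= k < n) sqmod (S x (e k))
             + nrm2 S (x - \sum_(0 <= k < n) S x (e k) *: e k).
Proof.
move=> eo; set s := \sum_(0 <= k < n) _ *: _.
rewrite -(nrm2_sum_ortho (fun k => S x (e k)) 0 n eo) -/s.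
rewrite -nrm2_orthoD; first by rewrite addrC subrK.
rewrite {1}/s ip_suml big_nat big1 // => k kn; rewrite ipZl ipBr.
rewrite [S (e k) x]ipC /s ip_sumr (bigD1_seq k) ?mem_index_iota ?iota_uniq //=.
rewrite ipZr eo eqxx mulr1 big1 ?addr0 ?subrr ?mulr0 // => j jk.
by rewrite ipZr eo eq_sym (negbTE jk) mulr0.
Qed.

End Orthonormal.

(** * Causal expansions, innovations and the projection on the future *)

Section CausalFactorization.
Context {R : realType} {V : lmodType R[i]} (S : sip V).
Variables (e p : int -> V) (d : nat -> R[i]).
Hypothesis e_orthonormal : forall i j, S (e i) (e j) = (i == j)%:R.
Hypothesis p_expansion : forall k : int,
  cvgH S (fun n => \sum_(u < n) d u *: e (k - u%:Z)) (p k).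
Hypothesis e_innovation : forall m : int, chull S p [set k | k <= m] (e m).

Let enat (k : nat) := e k%:Z.

Let enat_orthonormal i j : S (enat i) (enat j) = (i == j)%:R.
Proof. by rewrite e_orthonormal; congr ((_ : bool)%:R). Qed.

Lemma ip_expansion (j k : nat) :
  S (p j%:Z) (e k%:Z) = if (k <= j)%N then d (j - k)%N else 0.
Proof.
apply: (cvgH_ip_const (p_expansion _)); exists j.+1 => n jn.
rewrite ip_suml; case: leqP => kj.
  have ln : (j - k < n)%N by lia.
  rewrite (bigD1 (Ordinal ln)) //= ipZl e_orthonormal.
  have -> : (j%:Z - (j - k)%N%:Z == k%:Z) by lia.
  rewrite mulr1 big1 ?addr0 // => i /eqP il.
  rewrite ipZl e_orthonormal.
  have /negbTE -> : (j%:Z - i%:Z != k%:Z); last by rewrite mulr0.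
  by apply/eqP => H; apply: il; apply/val_inj => /=; lia.
rewrite big1 // => i _; rewrite ipZl e_orthonormal.
have /negbTE -> : (j%:Z - i%:Z != k%:Z); last by rewrite mulr0.
by lia.
Qed.

Lemma chull_past_sub x : chull S p [set k | k < 0] x -> chull S e [set k | k < 0] x.
Proof.
apply: chull_trans => i /= i0; apply: (cvgH_chull (p_expansion i)) => n.
apply: chull_sum => k _; apply/chullZ/chull_gen => /=; lia.
Qed.

(** The point where [e_innovation] enters. For a non-canonical expansion the past of [p] may be
    strictly smaller than the past of [e], and [A - r] need not lie in it. *)
Lemma chull_past_sup x : chull S e [set k | k < 0] x -> chull S p [set k | k < 0] x.
Proof.
apply: chull_trans => i /= i0; apply: (chull_trans _ (e_innovation i)) => k /= ki.
by apply: chull_gen => /=; lia.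
Qed.

Section Projection.
Variables A r : V.
Hypothesis A_hull : chull S p setT A.
Hypothesis r_proj :
  cvgH S (fun n => \sum_(0 <= k < n) S A (enat k) *: enat k) r.

Lemma ip_proj (k : nat) : S r (enat k) = S A (enat k).
Proof.
apply: (cvgH_ip_const r_proj); exists k.+1 => n kn.
rewrite ip_suml (bigD1_seq k) ?mem_index_iota ?iota_uniq ?kn //=.
rewrite ipZl enat_orthonormal eqxx mulr1 big1 ?addr0 // => j jk.
by rewrite ipZl enat_orthonormal (negbTE jk) mulr0.
Qed.

Lemma proj_chull : chull S e [set k | 0 <= k] r.
Proof.
apply: (cvgH_chull r_proj) => n; apply: chull_sum => k _.
exact/chullZ/chull_gen.
Qed.

Lemma proj_past_ortho x : chull S p [set k | k < 0] x -> S r x = 0.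
Proof.
move=> /chull_past_sub Hx.
apply: (chull_ortho _ proj_chull) => i /= i0.
rewrite ipC (@chull_ortho _ _ S _ e [set k | k < 0]) ?conjc0 // => j /= j0.
by rewrite e_orthonormal; case: eqP => // ij; lia.
Qed.

(** Subtracting [r] removes the coefficients of [A] at nonnegative indices; an element of the whole
    hull of [e] without such coefficients lies in the past of [e], which is the past of [p]. *)
Lemma sub_proj_past : chull S p [set k | k < 0] (A - r).
Proof.
apply/chull_past_sup/chull_ortho_compl => //.
  apply: chullB.
    apply: (chull_trans _ A_hull) => i _.
    apply: (cvgH_chull (p_expansion i)) => n.
    by apply: chull_sum => k _; exact/chullZ/chull_gen.
  by apply: (chull_trans _ proj_chull) => i _; exact: chull_gen.
by move=> [k|k] //= _; rewrite ipBl ip_proj subrr.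
Qed.

(** Pythagoras for [A - g = r + ((A - r) - g)]. The first term is the minimal error; the second
    vanishes only for [g] at distance zero from [A - r], which is the uniqueness of the optimum. *)
Lemma nrm2_sub_past g : chull S p [set k | k < 0] g ->
  nrm2 S (A - g) = nrm2 S r + nrm2 S ((A - r) - g).
Proof.
move=> Hg; have -> : A - g = r + ((A - r) - g) by rewrite addrA [r + _]addrC subrK.
by rewrite nrm2_orthoD // proj_past_ortho //; apply: chullB => //; exact: sub_proj_past.
Qed.

(** Parseval: the remainder in Bessel's identity for [r] tends to zero by the convergence of the
    projection series. *)
Lemma nrm2_proj : (fun n => \sum_(0 <= k < n) sqmod (S A (enat k))) @ \oo --> nrm2 S r.
Proof.
apply/cvgrPdist_lt => eps eps0; have [N HN] := r_proj eps0.
exists N => // n /= /HN; have := nrm2_sub_proj r n enat_orthonormal.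
have -> : \sum_(0 <= k < n) sqmod (S r (enat k)) = \sum_(0 <= k < n) sqmod (S A (enat k)).
  by apply: eq_bigr => k _; rewrite ip_proj.
have -> : \sum_(0 <= k < n) S r (enat k) *: enat k = \sum_(0 <= k < n) S A (enat k) *: enat k.
  by apply: eq_bigr => k _; rewrite ip_proj.
by move=> ->; rewrite addrAC subrr add0r ger0_norm ?nrm2_ge0.
Qed.

End Projection.

(** Riesz-Fischer: by Bessel the sums of squared coefficients are bounded, and their increments are
    the squared distances between the partial projections, which are therefore Cauchy. *)
Lemma proj_exists (A : V) : completeH S -> exists r,
  cvgH S (fun n => \sum_(0 <= k < n) S A (enat k) *: enat k) r.
Proof.
apply; pose s n := \sum_(0 <= k < n) sqmod (S A (enat k)).
have s_mono : {homo s : m n / (m <= n)%N >-> m <= n}.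
  move=> m n mn; rewrite /s (big_cat_nat (leq0n m) mn) //= lerDl.
  by rewrite sumr_ge0 // => i _; exact: sqmod_ge0.
have s_cvg : cvgn s.
  apply: nondecreasing_is_cvgn => //; exists (nrm2 S A) => _ [n _ <-].
  by rewrite (nrm2_sub_proj A n enat_orthonormal) lerDl nrm2_ge0.
have sle n : s n <= limn s by exact: nondecreasing_cvgn_le.
move/cvgrPdist_lt: (s_cvg) => s_lim eps eps0; have [N _ HN] := s_lim _ eps0.
have key m n : (N <= m)%N -> (m <= n)%N ->
    nrm2 S (\sum_(0 <= k < n) S A (enat k) *: enat k -
            \sum_(0 <= k < m) S A (enat k) *: enat k) < eps.
  move=> Nm mn; rewrite (big_cat_nat (leq0n m) mn) //= addrAC subrr add0r.
  rewrite (nrm2_sum_ortho (fun k => S A (enat k)) m n enat_orthonormal).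
  have := HN _ Nm; rewrite ger0_norm ?subr_ge0 // => H.
  have := sle n; rewrite /s (big_cat_nat (leq0n m) mn) //= => H'.
  by move: H; rewrite /s; lra.
exists N => m n Nm Nn; case/orP: (leq_total m n) => mn; last exact: key.
by rewrite nrm2_subC; exact: key.
Qed.

(** By causality only the indices [j = k + l] contribute. Truncated subtraction makes the sum empty
    for [k >= M], so coefficients beyond the last observation weight vanish. *)
Lemma ip_finite_sum (a : nat -> R[i]) (M k : nat) :
  S (\sum_(j < M) a j *: p j%:Z) (enat k) = \sum_(l < M - k) a (k + l)%N * d l.
Proof.
rewrite ip_suml; under eq_bigr do rewrite ipZl ip_expansion.
have [Mk|kM] := leqP M k.
  have -> : (M - k = 0)%N by lia.
  rewrite big_ord0 big1 // => i _; case: leqP => ki; last by rewrite mulr0.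
  by have := ltn_ord i; lia.
rewrite -(big_mkord xpredT (fun j => a j * (if (k <= j)%N then d (j - k)%N else 0))).
rewrite (@big_cat_nat _ _ _ k) //=; last exact: ltnW.
rewrite big_nat big1 ?add0r; last first.
  by move=> i /andP[_ ik]; rewrite leqNgt ik mulr0.
rewrite -{1}(add0n k) big_addn big_mkord; apply: eq_bigr => i _.
by rewrite leq_addl addnK addnC.
Qed.

(** The partial sum with [n + k] terms has as coefficient exactly the partial sum with [n] terms of
    the series for (Ad)_k. Convergence of that series is thus a consequence of continuity of the
    inner product, which justifies the [limn] inside [csum]. *)
Lemma ip_infinite_sum (a : nat -> R[i]) (A : V) (k : nat) :
  cvgH S (fun n => \sum_(j < n) a j *: p j%:Z) A -> S A (enat k) = Ad a d k.
Proof.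
move=> HA; pose b l := a (k + l)%N * d l.
have H (eps : R) : 0 < eps ->
   exists N, forall n, (N <= n)%N -> sqmod (S A (enat k) - \sum_(l < n) b l) < eps.
  move=> eps0; have [N HN] := cvgH_ip (enat k) HA eps0.
  exists N => n Nn; have := HN (n + k)%N; rewrite ip_finite_sum addnK; apply.
  by lia.
rewrite /Ad -/b /csum.
suff [-> ->] : limn (series (fun l => complex.Re (b l))) = complex.Re (S A (enat k))
   /\ limn (series (fun l => complex.Im (b l))) = complex.Im (S A (enat k)).
  by case: (S A (enat k)).
(* The squares of the real and imaginary parts are dominated by [sqmod], so tolerance [eps ^+ 2] for
   [sqmod] gives [eps] for each part. *)
split; apply/cvg_lim => //; apply/cvgrPdist_lt => eps eps0;
  have [|N HN] := H (eps ^+ 2); rewrite ?exprn_gt0 //; exists N => // n /= /HN HNn;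
  rewrite /series /= big_mkord -?cRe_sum -?cIm_sum;
  rewrite -ltr_sqr ?nnegrE ?(ltW eps0) ?normr_ge0 // real_normK ?num_real //;
  apply: le_lt_trans HNn; case: (S A _) (\sum_(i < n) b i) => [x y] [z t];
  rewrite /sqmod /=; [rewrite lerDl|rewrite lerDr]; exact: sqr_ge0.
Qed.

End CausalFactorization.

(** * The spaces L_2 *)

Section SquareIntegrable.
Context {R : realType} {d : measure_display} {T : measurableType d}.
Variables (mu : {measure set T -> \bar R}) (D : set T).
Hypothesis mD : measurable D.
Implicit Types g h k : T -> R[i].

Lemma cmeasurableD g h : cmeasurable D g -> cmeasurable D h ->
  cmeasurable D (fun x => g x + h x).
Proof.
move=> [g1 g2] [h1 h2]; split.
  by under eq_fun do rewrite cReD; exact: measurable_funD.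
by under eq_fun do rewrite cImD; exact: measurable_funD.
Qed.

Lemma cmeasurableM g h : cmeasurable D g -> cmeasurable D h ->
  cmeasurable D (fun x => g x * h x).
Proof.
move=> [g1 g2] [h1 h2]; split.
  rewrite (_ : (fun x => _) = (fun x => complex.Re (g x) * complex.Re (h x)
    - complex.Im (g x) * complex.Im (h x))); last first.
    by apply/funext => x; case: (g x) (h x) => [a b] [? ?].
  by apply: measurable_funB; exact: measurable_funM.
rewrite (_ : (fun x => _) = (fun x => complex.Re (g x) * complex.Im (h x)
  + complex.Im (g x) * complex.Re (h x))); last first.
  by apply/funext => x; case: (g x) (h x) => [a b] [? ?].
by apply: measurable_funD; exact: measurable_funM.
Qed.

Lemma cmeasurable_cst (c : R[i]) : cmeasurable D (fun=> c).
Proof. by split; exact: measurable_cst. Qed.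

Lemma cmeasurableN g : cmeasurable D g -> cmeasurable D (fun x => - g x).
Proof.
move=> mg; rewrite (_ : (fun x => _) = (fun x => (- 1) * g x)).
  by apply: cmeasurableM => //; exact: cmeasurable_cst.
by apply/funext => x; rewrite mulN1r.
Qed.

Lemma cmeasurableB g h : cmeasurable D g -> cmeasurable D h ->
  cmeasurable D (fun x => g x - h x).
Proof. by move=> mg mh; apply: cmeasurableD => //; exact: cmeasurableN. Qed.

Lemma cmeasurableJ g : cmeasurable D g -> cmeasurable D (fun x => conjc (g x)).
Proof.
move=> [g1 g2]; split.
  by under eq_fun do rewrite cReJ.
rewrite (_ : (fun x => _) = (fun x => - complex.Im (g x))).
  exact: measurable_funN.
by apply/funext => x; case: (g x).
Qed.

Lemma cmeasurable_real (f : T -> R) : measurable_fun D f ->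
  cmeasurable D (fun x => (f x)%:C).
Proof. by move=> mf; split => //=; exact: measurable_cst. Qed.

Lemma measurable_sqmod g : cmeasurable D g -> measurable_fun D (fun x => sqmod (g x)).
Proof.
by move=> [g1 g2]; apply: measurable_funD; apply: measurable_funX.
Qed.

Lemma measurable_inv_ge0 (f : T -> R) : (forall x, 0 <= f x) ->
  measurable_fun D f -> measurable_fun D (fun x => (f x)^-1).
Proof.
move=> f0 mf; under eq_fun do rewrite -powR_inv1 //.
apply: (@measurableT_comp _ _ _ _ _ _ (fun x : R => x `^ (-1)) _ f) => //.
Qed.

(** Conjugate over squared modulus is the inverse at 0 too, where both sides are 0 by convention;
    hence no condition on the zeros of [g]. *)
Lemma cmeasurableV g : cmeasurable D g -> cmeasurable D (fun x => (g x)^-1).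
Proof.
move=> mg; rewrite (_ : (fun x => _) = (fun x => ((sqmod (g x))^-1)%:C * conjc (g x))).
  apply: cmeasurableM; last exact: cmeasurableJ.
  by apply/cmeasurable_real/measurable_inv_ge0/measurable_sqmod => // x; exact: sqmod_ge0.
apply/funext => x; have [->|g0] := eqVneq (g x) 0.
  by rewrite conjc0 mulr0 invr0.
apply: (mulfI g0); rewrite divff // mulrCA mulcJ -rmorphM /= mulVf //.
by apply: contra_neq g0; exact: sqmod_eq0.
Qed.

Definition cintegrable k : Prop :=
  mu.-integrable D (EFin \o (fun x => complex.Re (k x))) /\
  mu.-integrable D (EFin \o (fun x => complex.Im (k x))).

Lemma inL2P g : inL2 mu D (cst 1) g <->
  cmeasurable D g /\ mu.-integrable D (EFin \o (fun x => sqmod (g x))).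
Proof.
rewrite /inL2; under eq_integral do rewrite mulr1.
split=> -[mg]; move: (measurable_sqmod mg) => ms.
  move=> H; split=> //; apply/integrableP; split; first exact/measurable_EFinP.
  by under eq_integral do rewrite /= ger0_norm ?sqmod_ge0 //.
move=> /integrableP[_ H]; split=> //; move: H.
by under eq_integral do rewrite /= ger0_norm ?sqmod_ge0 //.
Qed.

Lemma inL2_cintegrable g h : inL2 mu D (cst 1) g -> inL2 mu D (cst 1) h ->
  cintegrable (fun x => g x * conjc (h x)).
Proof.
move=> /inL2P[mg ig] /inL2P[mh ih].
have [m1 m2] := cmeasurableM mg (cmeasurableJ mh).
have ibound := integrableD mD ig ih.
split; apply: (le_integrable mD _ _ ibound); try exact/measurable_EFinP;
  move=> x _ /=; rewrite lee_fin; [exact: normRe_mulJ|exact: normIm_mulJ].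
Qed.

Lemma cintD k k' : cintegrable k -> cintegrable k' ->
  cint mu D (fun x => k x + k' x) = cint mu D k + cint mu D k'.
Proof.
move=> [k1 k2] [k1' k2']; rewrite /cint.
under eq_Rintegral do rewrite cReD.
under [X in _ +i* X]eq_Rintegral do rewrite cImD.
by rewrite !RintegralD.
Qed.

Lemma cintZ (c : R[i]) k : cintegrable k ->
  cint mu D (fun x => c * k x) = c * cint mu D k.
Proof.
case: c => a b [k1 k2]; rewrite /cint.
under eq_Rintegral => x _.
  rewrite (_ : complex.Re _ = a * complex.Re (k x) + (- b) * complex.Im (k x)); last first.
    by case: (k x) => ? ? /=; ring.
  over.
under [X in _ +i* X]eq_Rintegral => x _.
  rewrite (_ : complex.Im _ = a * complex.Im (k x) + b * complex.Re (k x)); last first.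
    by case: (k x) => ? ? /=; ring.
  over.
have iZ (r : R) (F : T -> R) : mu.-integrable D (EFin \o F) ->
  mu.-integrable D (EFin \o (fun x => r * F x)).
  by move=> /(integrableZl mD r).
rewrite !RintegralD ?iZ // !RintegralZl //.
by simpc; congr (_ +i* _); ring.
Qed.

Lemma cintJ k : cintegrable k ->
  cint mu D (fun x => conjc (k x)) = conjc (cint mu D k).
Proof.
move=> [k1 k2]; rewrite /cint; under eq_Rintegral do rewrite cReJ.
under [X in _ +i* X]eq_Rintegral => x _.
  rewrite (_ : complex.Im _ = (-1) * complex.Im (k x)); last first.
    by case: (k x) => ? ? /=; ring.
  over.
by rewrite RintegralZl //= mulN1r.
Qed.

Lemma inL2Zp (c : R[i]) g : inL2 mu D (cst 1) g ->
  inL2 mu D (cst 1) (fun x => c * g x).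
Proof.
move=> /inL2P[mg ig]; apply/inL2P; split.
  by apply: cmeasurableM => //; exact: cmeasurable_cst.
rewrite (_ : EFin \o _ = (fun x => (sqmod c)%:E * (sqmod (g x))%:E)%E).
  exact: integrableZl.
by apply/funext => x /=; rewrite sqmodM EFinM.
Qed.

Lemma inL2Dp g h : inL2 mu D (cst 1) g -> inL2 mu D (cst 1) h ->
  inL2 mu D (cst 1) (fun x => g x + h x).
Proof.
move=> /inL2P[mg ig] /inL2P[mh ih]; apply/inL2P.
have mgh := cmeasurableD mg mh; split => //.
have ib := integrableZl mD 2 (integrableD mD ig ih).
apply: (le_integrable mD _ _ ib); first by apply/measurable_EFinP/measurable_sqmod.
move=> x _ /=; rewrite lee_fin ger0_norm ?sqmod_ge0 //.
by apply: le_trans (ler_norm _); rewrite mulrDr; exact: sqmodD_le.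
Qed.

Lemma inL20 : inL2 mu D (cst 1) (fun=> 0).
Proof.
apply/inL2P; split; first exact: cmeasurable_cst.
by rewrite sqmod0; exact: integrable0.
Qed.

End SquareIntegrable.

Section L2Space.
Context {R : realType} {d : measure_display} {T : measurableType d}.

Definition L2pred (mu : {measure set T -> \bar R}) (D : set T)
  (mD : measurable D) : {pred T -> R[i]} := fun g => `[< inL2 mu D (cst 1) g >].

Variables (mu : {measure set T -> \bar R}) (D : set T) (mD : measurable D).

(** A submodule of the space of all functions: linear identities hold pointwise, and null sets are
    seen only by the seminorm. *)
Record L2space := L2Space { L2val :> T -> R[i]; L2valP : L2val \in L2pred mu mD }.

HB.instance Definition _ := [isSub for L2val].
HB.instance Definition _ := [Choice of L2space by <:].

Lemma L2pred_submod_closed : submod_closed (L2pred mu mD).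
Proof.
split; first by apply/asboolP; exact: inL20.
move=> c g h /asboolP Hg /asboolP Hh; apply/asboolP.
by apply: inL2Dp => //; exact: inL2Zp.
Qed.

HB.instance Definition _ :=
  GRing.isSubmodClosed.Build R[i] (T -> R[i]) (L2pred mu mD) L2pred_submod_closed.
HB.instance Definition _ := [SubChoice_isSubLmodule of L2space by <:].

Lemma L2P (g : L2space) : inL2 mu D (cst 1) g.
Proof. by apply/asboolP; exact: (L2valP g). Qed.

(** Made total by the default 0, so that it can be written before square integrability is
    established. *)
Definition mkL2 (g : T -> R[i]) : L2space :=
  if pselect (inL2 mu D (cst 1) g) is left Hg then L2Space (asboolT Hg) else 0.

Lemma mkL2E g : inL2 mu D (cst 1) g -> mkL2 g = g :> (T -> R[i]).
Proof. by rewrite /mkL2; case: pselect. Qed.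

Lemma L2_addE (g h : L2space) : (g + h : L2space) = (fun x => g x + h x) :> (T -> R[i]).
Proof. by []. Qed.

Lemma L2_scaleE c (g : L2space) : (c *: g : L2space) = (fun x => c * g x) :> (T -> R[i]).
Proof. by []. Qed.

Lemma L2_subE (g h : L2space) : (g - h : L2space) = (fun x => g x - h x) :> (T -> R[i]).
Proof. by []. Qed.

Lemma L2_sumE (I : Type) (l : seq I) (F : I -> L2space) :
  (\sum_(i <- l) F i : L2space) = (fun x => \sum_(i <- l) F i x) :> (T -> R[i]).
Proof.
elim: l => [|i l IH]; apply/funext => x; first by rewrite !big_nil.
by rewrite !big_cons L2_addE IH.
Qed.

Section L2sip.
Variable kappa : R.
Hypothesis kappa_gt0 : 0 < kappa.

(** The normalization [kappa] is 1 on the probability space and [(2 * pi)^-1] on the circle, where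
    it makes the exponentials orthonormal. *)
Definition L2ip (g h : L2space) : R[i] :=
  kappa%:C * cint mu D (fun x => g x * conjc (h x)).

Lemma L2ipDl x y z : L2ip (x + y) z = L2ip x z + L2ip y z.
Proof.
rewrite /L2ip L2_addE -mulrDr -cintD //; try exact/inL2_cintegrable/L2P/L2P.
congr (_ * _); congr (cint _ _ _); by apply/funext => t; rewrite mulrDl.
Qed.

Lemma L2ipZl c x z : L2ip (c *: x) z = c * L2ip x z.
Proof.
rewrite /L2ip L2_scaleE mulrCA -(cintZ mD c) //; try exact/inL2_cintegrable/L2P/L2P.
congr (_ * _); congr (cint _ _ _); by apply/funext => t; rewrite mulrA.
Qed.

Lemma L2ipC x y : L2ip x y = conjc (L2ip y x).
Proof.
rewrite /L2ip conjcM conjcr -cintJ //; try exact/inL2_cintegrable/L2P/L2P.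
congr (_ * _); congr (cint _ _ _); by apply/funext => t; rewrite conjcM conjcK mulrC.
Qed.

Lemma L2ip_self x :
  complex.Re (L2ip x x) = kappa * \int[mu]_(t in D) sqmod (x t).
Proof. by rewrite /L2ip cReMr /cint /=; under eq_Rintegral do rewrite mulcJ. Qed.

Lemma L2ip_ge0 x : 0 <= complex.Re (L2ip x x).
Proof.
rewrite L2ip_self mulr_ge0 ?(ltW kappa_gt0) // Rintegral_ge0 // => t _.
exact: sqmod_ge0.
Qed.

Definition L2sip : sip L2space := Sip L2ipDl L2ipZl L2ipC L2ip_ge0.

Lemma sqdist1E g h :
  sqdist mu D (cst 1) g h = (\int[mu]_(t in D) (sqmod (g t - h t))%:E)%E.
Proof. by rewrite /sqdist; under eq_integral do rewrite mulr1. Qed.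

Lemma nrm2_L2 (g : L2space) :
  (nrm2 L2sip g)%:E = (kappa%:E * \int[mu]_(t in D) (sqmod (g t))%:E)%E.
Proof.
have /(inL2P _ _)[_ ig] := L2P g.
have -> : nrm2 L2sip g = kappa * \int[mu]_(t in D) sqmod (g t) := L2ip_self g.
rewrite EFinM; congr (_ * _)%E.
by rewrite /Rintegral fineK //; exact: integrable_fin_num.
Qed.

Lemma nrm2_sqdist (g h : L2space) :
  (nrm2 L2sip (g - h))%:E = (kappa%:E * sqdist mu D (cst 1%R) g h)%E.
Proof. by rewrite nrm2_L2 sqdist1E. Qed.

End L2sip.
End L2Space.

(** * Completeness of L_2 *)

Section Completeness.
Context {R : realType}.

Lemma sum_pow2V_le n : \sum_(0 <= k < n) (2 ^+ k)^-1 <= 2 :> R.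
Proof.
have p2 : 0 < 2 ^+ n :> R by rewrite exprn_gt0.
suff -> : \sum_(0 <= k < n) (2 ^+ k)^-1 = 2 - 2 * (2 ^+ n)^-1 :> R.
  by rewrite lerBlDr lerDl mulr_ge0 // invr_ge0 ltW.
elim: n {p2} => [|n IH]; first by rewrite big_nil expr0 invr1; lra.
rewrite big_nat_recr //= IH exprS invfM; set y := (2 ^+ n)^-1; lra.
Qed.

(** A weighted form of the arithmetic-geometric inequality, |x| <= 2^-k + 2^k x^2, turns the bound
    on weighted squares into absolute summability of the increments, without square roots or
    Minkowski's inequality. *)
Lemma cvgn_of_sum_pow2_sqr (a : nat -> R) (C : R) :
  (forall n, \sum_(0 <= k < n) 2 ^+ k * (a k.+1 - a k) ^+ 2 <= C) -> cvgn a.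
Proof.
move=> HC; have p2 k : 0 < 2 ^+ k :> R by rewrite exprn_gt0.
have absb k : `|telescope a k| <= (2 ^+ k)^-1 + 2 ^+ k * (a k.+1 - a k) ^+ 2.
  rewrite -(real_normK (num_real (a k.+1 - a k))) /telescope.
  have := normr_ge0 (a k.+1 - a k); move: `|_| => c c0.
  have s0 : 0 <= (2 ^+ k)^-1 :> R by rewrite invr_ge0 ltW.
  have st : (2 ^+ k)^-1 * 2 ^+ k = 1 :> R by rewrite mulVf ?gt_eqF.
  move: (2 ^+ k) (_^-1) s0 st => t s s0 st.
  (* Since [s * t = 1], the product expands to s - c + t c^2, so its sign is the claimed bound. *)
  have H : 0 <= s * ((1 - t * c) ^+ 2 + t * c).
    apply: mulr_ge0 => //.
    by have := sqr_ge0 (1 - t * c); have := sqr_ge0 (t * c); nra.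
  have E : s * ((1 - t * c) ^+ 2 + t * c) = s - (s * t) * c + (s * t) * t * c ^+ 2.
    by ring.
  by move: H; rewrite E st !mul1r; lra.
have cs : cvgn (series (telescope a)).
  apply: normed_cvg; apply: nondecreasing_is_cvgn.
    by apply: nondecreasing_series => k _ _; exact: normr_ge0.
  exists (2 + C) => _ [n _ <-]; rewrite /series /=.
  apply: (@le_trans _ _ (\sum_(0 <= k < n) ((2 ^+ k)^-1 + 2 ^+ k * (a k.+1 - a k) ^+ 2))).
    by apply: ler_sum => k _; exact: absb.
  by rewrite big_split /= lerD // sum_pow2V_le.
rewrite (_ : a = series (telescope a) \+ cst (a 0%N)).
  by apply: is_cvgD => //; exact: is_cvg_cst.
by rewrite telescopeK; apply/funext => n /=; rewrite subrK.
Qed.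

Context {d : measure_display} {T : measurableType d}.
Variables (mu : {measure set T -> \bar R}) (D : set T) (mD : measurable D).
Variables (kappa : R) (kappa_gt0 : 0 < kappa).
Local Notation L2 := (L2space mu mD).
Local Notation S := (L2sip mu mD kappa_gt0).

Lemma nrm2_ltE (g h : L2) (e : R) :
  (nrm2 S (g - h) < kappa * e) =
  (\int[mu]_(t in D) (sqmod (g t - h t))%:E < e%:E)%E.
Proof.
rewrite -lte_fin nrm2_L2 EFinM lte_pmul2l ?lte_fin //.
Qed.

Lemma L2_fast_cvg (v : nat -> L2) :
  (forall k, (\int[mu]_(t in D) (sqmod (v k.+1 t - v k t))%:E <= ((4 ^+ k)^-1)%:E)%E) ->
  cauchyH S v -> exists g, cvgH S v g.
Proof.
move=> fast cau.
have mv k : cmeasurable D (v k) by case: (L2P (v k)).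
(* The weight 2^k costs half of the decay 4^-k: the integrals of [q k] remain summable, and
   finiteness of the sum [G x] is exactly the hypothesis of [cvgn_of_sum_pow2_sqr] for both parts of
   [v k x]. *)
pose q k x := 2 ^+ k * sqmod (v k.+1 x - v k x) : R.
have q0 k x : 0 <= q k x by rewrite mulr_ge0 ?exprn_ge0 ?sqmod_ge0.
have mq k : measurable_fun D (q k).
  by apply/measurable_funM => //; apply/measurable_sqmod => //; exact: cmeasurableB.
pose G x := (\sum_(k <oo) (q k x)%:E)%E.
have mG : measurable_fun D G.
  apply: ge0_emeasurable_sum => //; first by move=> k x _ _; rewrite lee_fin.
  by move=> k _; exact/measurable_EFinP.
have iG : (\int[mu]_(x in D) G x < +oo)%E.
  rewrite integral_nneseries //; last 2 first.
    by move=> k; exact/measurable_EFinP.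
    by move=> k x _; rewrite lee_fin.
  apply: (@le_lt_trans _ _ (\sum_(k <oo) ((2 ^+ k)^-1)%:E)%E).
    apply: lee_nneseries => [k _ _|k _].
      by apply: integral_ge0 => x _; rewrite lee_fin.
    under eq_integral do rewrite EFinM.
    rewrite ge0_integralZl_EFin ?exprn_ge0 //; last 2 first.
      by move=> x _; rewrite lee_fin sqmod_ge0.
      by apply/measurable_EFinP/measurable_sqmod => //; exact: cmeasurableB.
    apply: (@le_trans _ _ ((2 ^+ k)%:E * ((4 ^+ k)^-1)%:E)%E).
      by apply: lee_wpmul2l => //; rewrite lee_fin exprn_ge0.
    rewrite -EFinM lee_fin (_ : 4 = 2 * 2); last by ring.
    by rewrite exprMn invfM mulrA mulfV ?mul1r // expf_neq0.
  apply: (@le_lt_trans _ _ 2%:E); last exact: ltry.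
  apply: lime_le; first by apply: is_cvg_nneseries => k _ _; rewrite lee_fin invr_ge0 exprn_ge0.
  by apply: nearW => n; rewrite sumEFin lee_fin sum_pow2V_le.
have Gae : {ae mu, forall x, D x -> G x \is a fin_num}.
  apply: integrable_ae => //; apply/integrableP; split => //.
  rewrite (_ : (\int[mu]_(x in D) `|G x|)%E = (\int[mu]_(x in D) G x)%E) //.
  apply: eq_integral => x _; rewrite gee0_abs //.
  by apply: nneseries_ge0 => k _ _; rewrite lee_fin.
pose Good := D `&` [set x | G x \is a fin_num].
have mGood : measurable Good by exact: emeasurable_fin_num.
have conv x : Good x -> cvgn (fun k => complex.Re (v k x)) /\
                        cvgn (fun k => complex.Im (v k x)).
  move=> [Dx /= Gx].
  have bnd n : \sum_(0 <= k < n) q k x <= fine (G x).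
    rewrite -lee_fin fineK // -sumEFin.
    by apply: nneseries_lim_ge => k _ _; rewrite lee_fin.
  by split; apply: (@cvgn_of_sum_pow2_sqr _ (fine (G x))) => n;
    apply: le_trans (bnd n); apply: ler_sum => k _; rewrite ler_wpM2l ?exprn_ge0 //;
    case: (v k.+1 x) (v k x) => [a b] [a' b']; rewrite /sqmod /= ?lerDl ?lerDr sqr_ge0.
(* Cutting [v k] to zero off [Good] makes the limit exist at every point of [D], as measurability of
   the limit requires; almost everywhere nothing changes. *)
pose w k x := v k x * (\1_Good x)%:C.
have mw k : cmeasurable D (w k).
  by apply: cmeasurableM => //; apply/cmeasurable_real/measurable_indic.
pose g x := limn (fun k => complex.Re (w k x)) +i* limn (fun k => complex.Im (w k x)).
have wcvg x : D x -> (fun k => complex.Re (w k x)) @ \oo --> complex.Re (g x) /\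
                     (fun k => complex.Im (w k x)) @ \oo --> complex.Im (g x).
  move=> Dx; suff [c1 c2] : cvgn (fun k => complex.Re (w k x)) /\
                        cvgn (fun k => complex.Im (w k x)) by split.
  rewrite /w indicE; case: (boolP (x \in Good)) => xG /=.
    have [c1 c2] := conv x (set_mem xG).
    rewrite (_ : (fun k => complex.Re _) = (fun k => complex.Re (v k x))).
      rewrite (_ : (fun k => complex.Im _) = (fun k => complex.Im (v k x))) //.
      by apply/funext => k; rewrite mulr1.
    by apply/funext => k; rewrite mulr1.
  rewrite (_ : (fun k => complex.Re _) = cst 0).
    rewrite (_ : (fun k => complex.Im _) = cst 0); first by split; exact: is_cvg_cst.
    by apply/funext => k; rewrite mulr0.
  by apply/funext => k; rewrite mulr0.
have mg : cmeasurable D g.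
  split.
    apply: (@measurable_fun_cvg _ _ _ D (fun k x => complex.Re (w k x))) => [m|x /wcvg[]//].
    by case: (mw m).
  apply: (@measurable_fun_cvg _ _ _ D (fun k x => complex.Im (w k x))) => [m|x /wcvg[]//].
  by case: (mw m).
have vw m : ae_eq mu D (fun x => (sqmod (g x - w m x))%:E)
                       (fun x => (sqmod (g x - v m x))%:E).
  apply: filterS Gae => x Gx Dx /=.
  have xG : x \in Good by apply: mem_set; split => //; exact: Gx.
  by rewrite /w indicE xG mulr1.
(* Fatou's lemma in the first index, with [m] fixed. The half of [e] leaves room for the strict
   inequality lost in the limit. *)
have close (e : R) : 0 < e -> exists N, forall m, (N <= m)%N ->
    (\int[mu]_(x in D) (sqmod (g x - v m x))%:E < e%:E)%E.
  move=> e0; have [|N HN] := cau (kappa * (e / 2)); first by rewrite mulr_gt0 ?divr_gt0.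
  exists N => m Nm; apply: (@le_lt_trans _ _ (e / 2)%:E); last by rewrite lte_fin; lra.
  rewrite -(ge0_ae_eq_integral _ _ _ _ _ (vw m)) //; first last.
    by move=> x _; rewrite lee_fin sqmod_ge0.
    by move=> x _; rewrite lee_fin sqmod_ge0.
    by apply/measurable_EFinP/measurable_sqmod => //; exact: cmeasurableB.
    by apply/measurable_EFinP/measurable_sqmod => //; exact: cmeasurableB.
  pose F k x := (sqmod (w k x - w m x))%:E.
  have mF k : measurable_fun D (F k).
    by apply/measurable_EFinP/measurable_sqmod => //; exact: cmeasurableB.
  have F0 k x : D x -> (0 <= F k x)%E by move=> _; rewrite lee_fin sqmod_ge0.
  have := fatou mu mD mF F0; have -> : (\int[mu]_(x in D) limn_einf (F^~ x) =
     \int[mu]_(x in D) (sqmod (g x - w m x))%:E)%E.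
    apply: eq_integral => x /set_mem Dx.
    have [rc ic] := wcvg x Dx.
    apply: (cvg_limn_einf_sup _).1; apply: cvg_EFin; first exact: nearW.
    rewrite /F /= /comp /= /sqmod /=.
    by under eq_fun do rewrite cReD cImD cReN cImN; rewrite cReD cImD cReN cImN;
       apply: cvgD; apply: (@cvgM _ _ _ _ (fun k => _ (w k x) + _) (fun k => _ (w k x) + _));
       apply: cvgD => //; exact: cvg_cst.
  move/le_trans; apply; rewrite limn_einf_lim.
  apply: lime_le; first exact: is_cvg_einfs.
  near=> n; apply: (@le_trans _ _ (\int[mu]_(x in D) F n x)%E).
    by apply: ereal_inf_lbound; exists n => /=.
  apply: (@le_trans _ _ (\int[mu]_(x in D) (sqmod (v n x - v m x))%:E)%E).
    apply: ge0_le_integral => //.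
    - by move=> x _; rewrite lee_fin sqmod_ge0.
    - by apply/measurable_EFinP/measurable_sqmod => //; exact: cmeasurableB.
    - move=> x _; rewrite lee_fin /w -mulrBl sqmodM ler_piMr ?sqmod_ge0 //.
      rewrite /sqmod /= expr0n addr0 indicE; case: (_ \in _) => /=.
        by rewrite expr1n.
      by rewrite expr0n.
  apply: ltW; rewrite -nrm2_ltE; apply: HN => //; near: n.
  by exists N.
have [N HN] := close _ ltr01.
have gL2 : inL2 mu D (cst 1) g.
  have -> : g = (fun x => (g x - v N x) + v N x) by apply/funext => x; rewrite subrK.
  apply: inL2Dp => //; last exact: L2P.
  split; first exact: cmeasurableB.
  by under eq_integral do rewrite mulr1; rewrite (lt_trans (HN _ (leqnn _))) ?ltry.
exists (mkL2 mu mD g) => e e0.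
have [|M HM] := close (e / kappa); first by rewrite divr_gt0.
exists M => n Mn; have -> : e = kappa * (e / kappa) by rewrite mulrC divfK ?gt_eqF.
by rewrite nrm2_ltE mkL2E //; exact: HM.
Unshelve. all: end_near. Qed.

Lemma L2_complete : completeH S.
Proof.
move=> u cau.
have /choice[N HN] : forall k, exists N, forall m n, (N <= m)%N -> (N <= n)%N ->
    nrm2 S (u m - u n) < kappa * (4 ^+ k)^-1.
  by move=> k; apply: cau; rewrite mulr_gt0 // invr_gt0 exprn_gt0.
(* [s] dominates every [N k], is nondecreasing and is at least the identity; so [u \o s] is Cauchy
   and has the increments demanded by [L2_fast_cvg]. *)
pose s k := (\sum_(j < k.+1) N j + k)%N.
have sN k : (N k <= s k)%N.
  by rewrite /s big_ord_recr /= -addnA addnCA leq_addr.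
have sS k : (s k <= s k.+1)%N.
  by rewrite /s [in leqRHS]big_ord_recr /= -!addnA leq_add2l; lia.
have sk k : (k <= s k)%N by rewrite leq_addl.
have cauv : cauchyH S (u \o s).
  move=> e /cau[M HM]; exists M => m n Mm Mn.
  by apply: HM; apply: leq_trans (sk _).
have [|g Hg] := L2_fast_cvg _ cauv.
  move=> k; apply: ltW; rewrite -nrm2_ltE; apply: HN => //.
  exact: leq_trans (sS k).
exists g => e e0; have e4 : 0 < e / 4 by lra.
have [M1 HM1] := Hg _ e4; have [M2 HM2] := cau _ e4.
exists M2 => n M2n; set m := s (maxn M1 M2).
have H1 : nrm2 S (g - u m) < e / 4 := HM1 _ (leq_maxl M1 M2).
have H2 : nrm2 S (u m - u n) < e / 4.
  by apply: HM2 => //; exact: leq_trans (leq_maxr M1 M2) (sk _).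
apply: (le_lt_trans (nrm2_tri S (u m) g (u n))).
have aux (x y : R) : x < e / 4 -> y < e / 4 -> 2 * x + 2 * y < e by lra.
exact: aux.
Qed.

End Completeness.

Lemma ereal_cvg0P (R : realType) (F : nat -> \bar R) : (forall n, (0 <= F n)%E) ->
  (F @ \oo --> (0 : \bar R) <-> forall e : R, 0 < e ->
     exists N, forall n, (N <= n)%N -> (F n < e%:E)%E).
Proof.
move=> F0; split=> [/fine_cvgP[Ffin /cvgrPdist_lt H] e e0|H].
  have [N _ HN] : \forall n \near \oo, (F n < e%:E)%E.
    near=> n; have Fn : F n \is a fin_num by near: n.
    rewrite -(fineK Fn) lte_fin; have : `|0 - fine (F n)| < e by near: n; exact: H.
    by rewrite sub0r normrN; exact: le_lt_trans (ler_norm _).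
  by exists N => n /HN.
have fin n e : (F n < e%:E)%E -> F n \is a fin_num.
  by move=> Fe; rewrite ge0_fin_numE // (lt_trans Fe) ?ltry.
apply/fine_cvgP; split.
  by have [N HN] := H _ ltr01; exists N => // n /HN; exact: fin.
apply/cvgrPdist_lt => e e0; have [N HN] := H _ e0; exists N => // n /HN Fe /=.
rewrite sub0r normrN ger0_norm ?fine_ge0 // -lte_fin fineK //; exact: fin Fe.
Unshelve. all: end_near. Qed.

(** Bridges two encodings: [chull] uses lists of pairs with repetitions, [closed_span] a list of
    indices with one coefficient function. Coefficients of equal indices have to be added, uniformly
    in the vectors. *)
Lemma lincomb_merge (R : realType) (I : eqType) (l : seq (R[i] * I)) :
  exists (s : seq I) (c : I -> R[i]), [/\ uniq s, {subset s <= map snd l} &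
    forall (V : lmodType R[i]) (u : I -> V),
      \sum_(k <- s) c k *: u k = lincomb u l].
Proof.
elim: l => [|[a i] l [s [c [us sl Hs]]]].
  by exists [::], (fun=> 0); split=> // V u; rewrite /lincomb !big_nil.
pose c' k := if k == i then a + (if i \in s then c i else 0) else c k.
exists (if i \in s then s else i :: s), c'; split.
- by case: ifP => //= ->.
- move=> k; case: ifP => iS; rewrite !inE; first by move=> /sl ->; rewrite orbT.
  by case/orP => [->//|/sl ->]; rewrite orbT.
- move=> V u; rewrite /lincomb big_cons -/(lincomb u l) -Hs /=.
  case: ifP => iS.
    rewrite !(bigD1_seq i) //= /c' eqxx iS scalerDl -addrA; congr (_ + (_ + _)).
    by apply: eq_bigr => k /negbTE ->.
  rewrite big_cons /c' eqxx iS addr0; congr (_ + _).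
  by apply: eq_big_seq => k ks; case: eqP => // ki; rewrite -ki ks in iS.
Qed.

(** * Weighted L_2 spaces inside the unweighted one *)

Section WeightedL2.
Context {R : realType} {d : measure_display} {T : measurableType d}.
Variables (mu : {measure set T -> \bar R}) (D : set T) (mD : measurable D).
Variables (kappa : R) (kappa_gt0 : 0 < kappa).
Variables (w : T -> R) (phi : T -> R[i]).
Hypothesis mw : measurable_fun D w.
Hypothesis mphi : cmeasurable D phi.
Hypothesis w_phi : {ae mu, forall x, D x -> w x = sqmod (phi x)}.
Hypothesis w_ge0 : forall x, D x -> 0 <= w x.
Local Notation L2 := (L2space mu mD).
Local Notation S := (L2sip mu mD kappa_gt0).
Implicit Types g h : T -> R[i].

(* [g |-> phi g] identifies L_2(w) with a subspace of the unweighted L_2. *)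
Definition wlift g : L2 := mkL2 mu mD (fun x => phi x * g x).

Lemma integral_wlift g : cmeasurable D g ->
  (\int[mu]_(x in D) (sqmod (g x) * w x)%:E =
   \int[mu]_(x in D) (sqmod (phi x * g x))%:E)%E.
Proof.
move=> mg; apply: ge0_ae_eq_integral => //.
- by apply/measurable_EFinP/measurable_funM => //; exact: measurable_sqmod.
- by apply/measurable_EFinP/measurable_sqmod => //; exact: cmeasurableM.
- by move=> x Dx; rewrite lee_fin mulr_ge0 ?sqmod_ge0 ?w_ge0.
- by move=> x Dx; rewrite lee_fin sqmod_ge0.
- by apply: filterS w_phi => x wx Dx; rewrite wx // sqmodM mulrC.
Qed.

Lemma inL2w g : inL2 mu D w g <->
  cmeasurable D g /\ inL2 mu D (cst 1) (fun x => phi x * g x).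
Proof.
split=> [[mg]|[mg [_]]].
  rewrite integral_wlift // => H; split=> //; split; first exact: cmeasurableM.
  by under eq_integral do rewrite mulr1.
by under eq_integral do rewrite mulr1; rewrite -integral_wlift.
Qed.

Lemma wliftE g : inL2 mu D w g -> wlift g = (fun x => phi x * g x) :> (T -> R[i]).
Proof. by move=> /inL2w[_ H]; rewrite /wlift mkL2E. Qed.

Lemma inL2wD g h : inL2 mu D w g -> inL2 mu D w h ->
  inL2 mu D w (fun x => g x + h x).
Proof.
move=> /inL2w[mg Hg] /inL2w[mh Hh]; apply/inL2w; split; first exact: cmeasurableD.
by under eq_fun do rewrite mulrDr; exact: inL2Dp.
Qed.

Lemma inL2wZ c g : inL2 mu D w g -> inL2 mu D w (fun x => c * g x).
Proof.
move=> /inL2w[mg Hg]; apply/inL2w; split.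
  by apply: cmeasurableM => //; exact: cmeasurable_cst.
by under eq_fun do rewrite mulrCA; exact: inL2Zp.
Qed.

Lemma inL2w0 : inL2 mu D w (fun=> 0).
Proof.
apply/inL2w; split; first exact: cmeasurable_cst.
by under eq_fun do rewrite mulr0; exact: inL20.
Qed.

Lemma inL2w_sum (I : Type) (l : seq I) (F : I -> T -> R[i]) :
  (forall i, inL2 mu D w (F i)) -> inL2 mu D w (fun x => \sum_(i <- l) F i x).
Proof.
move=> HF; elim: l => [|i l IH].
  by under eq_fun do rewrite big_nil; exact: inL2w0.
by under eq_fun do rewrite big_cons; exact: inL2wD.
Qed.

Lemma wlift_lincomb (I : Type) (l : seq I) (c : I -> R[i]) (F : I -> T -> R[i]) :
  (forall i, inL2 mu D w (F i)) ->
  wlift (fun x => \sum_(i <- l) c i * F i x) = \sum_(i <- l) c i *: wlift (F i).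
Proof.
move=> HF; apply: val_inj => /=; rewrite wliftE; last first.
  by apply: inL2w_sum => i; exact: inL2wZ.
rewrite L2_sumE; apply/funext => x; rewrite mulr_sumr; apply: eq_bigr => i _.
by rewrite L2_scaleE wliftE // mulrCA.
Qed.

Lemma nrm2_wlift g h : inL2 mu D w g -> inL2 mu D w h ->
  (nrm2 S (wlift g - wlift h))%:E = (kappa%:E * sqdist mu D w g h)%E.
Proof.
move=> Hg Hh; rewrite nrm2_sqdist sqdist1E !wliftE //; congr (_ * _)%E.
rewrite /sqdist integral_wlift; last first.
  by case: Hg Hh => mg _ [mh _]; exact: cmeasurableB.
by apply: eq_integral => x _; rewrite mulrBr.
Qed.

Lemma sqdist_lt g h (e : R) : inL2 mu D w g -> inL2 mu D w h ->
  (sqdist mu D w g h < e%:E)%E = (nrm2 S (wlift g - wlift h) < kappa * e).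
Proof.
by move=> Hg Hh; rewrite -lte_fin nrm2_wlift // EFinM lte_pmul2l ?lte_fin.
Qed.

Lemma sqdist_ge0 g h : (0 <= sqdist mu D w g h)%E.
Proof.
by apply: integral_ge0 => x Dx; rewrite lee_fin mulr_ge0 ?sqmod_ge0 ?w_ge0.
Qed.

Lemma sqdist_cvg0P g (h : nat -> T -> R[i]) : inL2 mu D w g ->
  (forall n, inL2 mu D w (h n)) ->
  (fun n => sqdist mu D w g (h n)) @ \oo --> (0 : \bar R) <->
  cvgH S (fun n => wlift (h n)) (wlift g).
Proof.
move=> Hg Hh; rewrite ereal_cvg0P; last by move=> n; exact: sqdist_ge0.
split=> H e e0.
  have [|N HN] := H (e / kappa); first by rewrite divr_gt0.
  exists N => n /HN; rewrite sqdist_lt // mulrC divfK ?gt_eqF //.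
have [|N HN] := H (kappa * e); first by rewrite mulr_gt0.
by exists N => n /HN; rewrite -sqdist_lt.
Qed.

Lemma L2_sumP (u : nat -> T -> R[i]) g : (forall k, inL2 mu D w (u k)) ->
  L2_sum mu D w u g <->
  inL2 mu D w g /\ cvgH S (fun n => \sum_(k < n) wlift (u k)) (wlift g).
Proof.
move=> Hu; rewrite /L2_sum.
have Hs n : inL2 mu D w (fun x => \sum_(k < n) u k x) by exact: inL2w_sum.
have E n : wlift (fun x => \sum_(k < n) u k x) = \sum_(k < n) wlift (u k).
  have := @wlift_lincomb _ (index_enum 'I_n) (fun=> 1) (fun k => u k) (fun k => Hu k).
  under eq_fun do under eq_bigr do rewrite mul1r.
  by under [in RHS]eq_bigr do rewrite scale1r.
have -> : (fun n => \sum_(k < n) wlift (u k)) =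
          (fun n => wlift (fun x => \sum_(k < n) u k x)).
  by apply/funext => n; rewrite E.
split=> -[Hg H]; split => //.
  exact/(sqdist_cvg0P Hg Hs).
exact/(sqdist_cvg0P Hg Hs).
Qed.

Lemma closed_spanP (u : int -> T -> R[i]) (J : pred int) g :
  (forall k, inL2 mu D w (u k)) ->
  closed_span mu D w u J g <->
  inL2 mu D w g /\ chull S (fun k => wlift (u k)) [set k | J k] (wlift g).
Proof.
move=> Hu; split=> -[Hg H]; split=> // e e0.
  have [|s [c [Js sc]]] := H (e / kappa); first by rewrite divr_gt0.
  exists [seq (c k, k) | k <- s]; split.
    by rewrite all_map; apply/allP => k ks /=; apply/mem_set/(allP Js).
  rewrite /lincomb big_map -wlift_lincomb //; move: sc.
  rewrite sqdist_lt // ?(mulrC kappa) ?divfK ?gt_eqF //.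
  by apply: inL2w_sum => k; exact: inL2wZ.
have [|l [Jl lc]] := H (kappa * e); first by rewrite mulr_gt0.
have [s [c [us sl Hs]]] := lincomb_merge l.
exists s, c; split.
  apply/allP => k /sl /mapP[p pl ->]; exact: set_mem (allP Jl _ pl).
rewrite sqdist_lt //; last by apply: inL2w_sum => k; exact: inL2wZ.
by rewrite wlift_lincomb // Hs.
Qed.

End WeightedL2.

(** * Trigonometric system and stochastic integral *)

Section Circle.
Context {R : realType}.
Local Notation leb := (@lebesgue_measure R).
Implicit Types (x y : R) (j k : int).

Lemma expiD x y : expi (x + y) = expi x * expi y.
Proof. by rewrite /expi cosD sinD; simpc; congr (_ +i* _); ring. Qed.

Lemma expiJ x : conjc (expi x) = expi (- x).
Proof. by rewrite /expi cosN sinN. Qed.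

Lemma sqmod_expi x : sqmod (expi x) = 1.
Proof. by rewrite /sqmod /= cos2Dsin2. Qed.

Lemma measurable_circle : measurable (circle : set R).
Proof. exact: measurable_itv. Qed.

Lemma two_pi_gt0 : 0 < 2 * pi :> R.
Proof. by rewrite mulr_gt0 ?pi_gt0. Qed.

Lemma inv_two_pi_gt0 : 0 < (2 * pi)^-1 :> R.
Proof. by rewrite invr_gt0 two_pi_gt0. Qed.

Lemma lebesgue_circle : leb (circle : set R) = (2 * pi)%:E.
Proof.
rewrite /circle lebesgue_measure_itv /= lte_fin ifT; last first.
  by have := @pi_gt0 R; lra.
by rewrite -EFinB; congr (_%:E); lra.
Qed.

Lemma sin_mul_int_pi k : sin (k%:~R * pi) = 0 :> R.
Proof.
have H n : sin (n%:R * pi) = 0 :> R.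
  elim: n => [|n IH]; first by rewrite mul0r sin0.
  by rewrite -addn1 natrD mulrDl mul1r sinDpi IH oppr0.
case: k => n; first exact: H.
by rewrite NegzE mulrNz mulNr sinN (H n.+1) oppr0.
Qed.

Lemma continuous_scale (c : R) : continuous (fun x : R => c * x).
Proof. by move=> x; exact: mulrl_continuous. Qed.

Lemma integral_of_primitive (f F : R -> R) :
  continuous f -> (forall x, is_derive x 1 F (f x)) ->
  \int[leb]_(x in circle) f x = F pi - F (- pi).
Proof.
move=> cf dF; have cF : continuous F.
  by move=> x; apply/differentiable_continuous/derivable1_diffP; case: (dF x).
rewrite /Rintegral /circle (@continuous_FTC2 _ f F) //.
- by have := @pi_gt0 R; lra.
- exact: continuous_subspaceT.
- split; first by move=> x _; case: (dF x).
  + by apply: cvg_at_right_filter; exact: cF.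
  + by apply: cvg_at_left_filter; exact: cF.
- by move=> x _; rewrite derive1E; case: (dF x).
Qed.

Lemma cint_expi k :
  cint leb circle (fun x => expi (k%:~R * x)) = ((2 * pi) * (k == 0)%:R)%:C.
Proof.
have [->|k0] := eqVneq k 0; rewrite /cint /=.
  rewrite (_ : (fun x => cos _) = cst 1); last first.
    by apply/funext => x; rewrite mul0r cos0.
  rewrite (_ : (fun x => sin _) = cst 0); last first.
    by apply/funext => x; rewrite mul0r sin0.
  rewrite !Rintegral_cst ?lebesgue_circle; try exact: measurable_circle.
  by rewrite /= mul0r mul1r mulr1 lebesgue_circle.
have kr : k%:~R != 0 :> R by rewrite intr_eq0.
have cc : continuous (fun x : R => cos (k%:~R * x)).
  by move=> x; apply: continuous_comp; [exact: continuous_scale|exact: continuous_cos].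
have cs : continuous (fun x : R => sin (k%:~R * x)).
  by move=> x; apply: continuous_comp; [exact: continuous_scale|exact: continuous_sin].
have dk x : is_derive x 1 (fun y : R => k%:~R * y) k%:~R.
  have := is_deriveZ (k%:~R : R) (is_derive_id x 1).
  by rewrite /GRing.scale /= mulr1.
have dsin x : is_derive x 1 (fun y : R => k%:~R^-1 * sin (k%:~R * y)) (cos (k%:~R * x)).
  have := is_deriveZ (k%:~R^-1 : R) (is_derive1_comp (is_derive_sin (k%:~R * x)) (dk x)).
  by rewrite /GRing.scale /= mulrCA mulVf // mulr1.
have dcos x : is_derive x 1 (fun y : R => (- k%:~R^-1) * cos (k%:~R * y)) (sin (k%:~R * x)).
  have := is_deriveZ (- k%:~R^-1 : R) (is_derive1_comp (is_derive_cos (k%:~R * x)) (dk x)).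
  by rewrite /GRing.scale /= mulNr mulrCA mulVf // mulr1 opprK.
rewrite (integral_of_primitive cc dsin) (integral_of_primitive cs dcos).
(* Both primitives agree at the endpoints: cosine is even, and sine vanishes at integer multiples of
   pi. *)
rewrite !mulrN sinN cosN subrr sin_mul_int_pi; congr (_ +i* _).
by rewrite ?(mulr0, oppr0, addr0).
Qed.

Lemma cmeasurable_expi k : cmeasurable circle (fun x : R => expi (k%:~R * x)).
Proof.
split => /=; apply: measurable_funTS; apply: continuous_measurable_fun => x;
  apply: continuous_comp; try exact: continuous_scale.
  exact: continuous_cos.
exact: continuous_sin.
Qed.

Lemma inL2_expi k : inL2 leb circle (cst 1) (fun x : R => expi (k%:~R * x)).
Proof.
split; first exact: cmeasurable_expi.
under eq_integral do rewrite sqmod_expi mulr1.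
rewrite integral_cst; last exact: measurable_circle.
by rewrite /= mul1e lebesgue_circle ltry.
Qed.

Local Notation K := (L2space leb measurable_circle).
Local Notation SK := (L2sip leb measurable_circle inv_two_pi_gt0).

Definition trig k : K := mkL2 leb measurable_circle (fun x : R => expi (k%:~R * x)).

Lemma trigE k : trig k = (fun x => expi (k%:~R * x)) :> (R -> R[i]).
Proof. by rewrite /trig mkL2E //; exact: inL2_expi. Qed.

Lemma trig_orthonormal j k : SK (trig j) (trig k) = (j == k)%:R.
Proof.
rewrite /= /L2ip !trigE.
have -> : (fun x : R => expi (j%:~R * x) * conjc (expi (k%:~R * x))) =
          (fun x => expi ((j - k)%:~R * x)).
  by apply/funext => x; rewrite expiJ -expiD rmorphB /= mulrBl.
rewrite cint_expi subr_eq0 -rmorphM /= mulrA mulVf ?mul1r; first by case: (j == k).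
exact: lt0r_neq0 two_pi_gt0.
Qed.

End Circle.

Section UnweightedL2.
Context {R : realType} {d : measure_display} {T : measurableType d}.
Variables (mu : {measure set T -> \bar R}) (D : set T) (mD : measurable D).
Variables (kappa : R) (kappa_gt0 : 0 < kappa).
Local Notation S := (L2sip mu mD kappa_gt0).
Implicit Types g h : T -> R[i].

Let m1 : measurable_fun D (cst 1 : T -> R). Proof. exact: measurable_cst. Qed.
Let mc1 : cmeasurable D (cst 1 : T -> R[i]). Proof. exact: cmeasurable_cst. Qed.
Let ae1 : {ae mu, forall x, D x -> (cst 1 x : R) = sqmod (cst 1 x : R[i])}.
Proof. by apply: nearW => x _; rewrite /sqmod /= expr1n expr0n addr0. Qed.
Let ge1 : forall x, D x -> 0 <= (cst 1 x : R). Proof. by []. Qed.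

(** The unweighted statements are the weighted ones with both the weight and its factor equal to
    1. *)
Let wlift1 g : wlift mu mD (cst 1) g = mkL2 mu mD g.
Proof. by rewrite /wlift; congr mkL2; apply/funext => x; rewrite mul1r. Qed.

Lemma mkL2_lincomb (I : Type) (l : seq I) (c : I -> R[i]) (F : I -> T -> R[i]) :
  (forall i, inL2 mu D (cst 1) (F i)) ->
  mkL2 mu mD (fun x => \sum_(i <- l) c i * F i x) = \sum_(i <- l) c i *: mkL2 mu mD (F i).
Proof.
move=> HF; rewrite -wlift1 (wlift_lincomb mD m1 mc1 ae1 ge1 _ _ HF).
by apply: eq_bigr => i _; rewrite wlift1.
Qed.

Lemma inL2_sum (I : Type) (l : seq I) (F : I -> T -> R[i]) :
  (forall i, inL2 mu D (cst 1) (F i)) ->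
  inL2 mu D (cst 1) (fun x => \sum_(i <- l) F i x).
Proof. exact: (inL2w_sum mD m1 mc1 ae1 ge1). Qed.

Lemma nrm2_mkL2 g h : inL2 mu D (cst 1) g -> inL2 mu D (cst 1) h ->
  (nrm2 S (mkL2 mu mD g - mkL2 mu mD h))%:E = (kappa%:E * sqdist mu D (cst 1%R) g h)%E.
Proof.
by move=> Hg Hh; rewrite -!wlift1 (nrm2_wlift mD kappa_gt0 m1 mc1 ae1 ge1 Hg Hh).
Qed.

Lemma L2_sum1P (u : nat -> T -> R[i]) g : (forall k, inL2 mu D (cst 1) (u k)) ->
  L2_sum mu D (cst 1) u g <->
  inL2 mu D (cst 1) g /\ cvgH S (fun n => \sum_(k < n) mkL2 mu mD (u k)) (mkL2 mu mD g).
Proof.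
move=> Hu; rewrite (L2_sumP mD kappa_gt0 m1 mc1 ae1 ge1 _ Hu) wlift1.
rewrite (_ : (fun n => \sum_(k < n) wlift _ _ _ _) =
             (fun n => \sum_(k < n) mkL2 mu mD (u k))) //.
by apply/funext => n; apply: eq_bigr => k _; rewrite wlift1.
Qed.

Lemma closed_span1P (u : int -> T -> R[i]) (J : pred int) g :
  (forall k, inL2 mu D (cst 1) (u k)) ->
  closed_span mu D (cst 1) u J g <->
  inL2 mu D (cst 1) g /\ chull S (fun k => mkL2 mu mD (u k)) [set k | J k] (mkL2 mu mD g).
Proof.
move=> Hu; rewrite (closed_spanP mD kappa_gt0 m1 mc1 ae1 ge1 _ _ Hu) wlift1.
rewrite (_ : (fun k => wlift _ _ _ _) = (fun k => mkL2 mu mD (u k))) //.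
by apply/funext => k; rewrite wlift1.
Qed.

End UnweightedL2.

Lemma chull_subset (R : realType) (V : lmodType R[i]) (S : sip V) (I : Type) (u : I -> V)
    (J J' : set I) x : J `<=` J' -> chull S u J x -> chull S u J' x.
Proof. by move=> JJ; apply: chull_trans => i /JJ; exact: chull_gen. Qed.

Lemma ae_weaken (R : realType) d (T : measurableType d)
    (mu : {measure set T -> \bar R}) (A B : T -> Prop) :
  (forall x, A x -> B x) -> {ae mu, forall x, A x} -> {ae mu, forall x, B x}.
Proof. by move=> AB; apply: filterS. Qed.

Lemma ae_weaken2 (R : realType) d (T : measurableType d)
    (mu : {measure set T -> \bar R}) (A B C : T -> Prop) :
  (forall x, A x -> B x -> C x) ->
  {ae mu, forall x, A x} -> {ae mu, forall x, B x} -> {ae mu, forall x, C x}.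
Proof. by move=> ABC; apply: filterS2. Qed.

Lemma chull_ext (R : realType) (V : lmodType R[i]) (S : sip V) (I : Type)
    (u : I -> V) (J : set I) (x y : V) :
  nrm2 S (x - y) = 0 -> chull S u J x -> chull S u J y.
Proof.
by move=> xy Hx; apply: chull_lim => e e0; exists x => //; rewrite nrm2_subC xy.
Qed.

(** * The stochastic integral as a closed graph *)

Section StochasticIntegral.
Context {R : realType} {dT : measure_display} {T : measurableType dT}.
Variables (P : probability T R) (f : R -> R) (Z : set R -> T -> R[i]).
Variable phi : R -> R[i].
Local Notation leb := (@lebesgue_measure R).
Hypothesis mf : measurable_fun circle f.
Hypothesis f_ge0 : forall x, circle x -> 0 <= f x.
Hypothesis f_int : (\int[leb]_(x in circle) (f x)%:E < +oo)%E.
Hypothesis mphi : cmeasurable circle phi.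
Hypothesis f_phi : {ae leb, forall x, circle x -> f x = sqmod (phi x)}.
Hypothesis Z_orthogonal : orthogonal_random_measure P f Z.

Local Notation mcirc := (@measurable_circle R).
Local Notation K := (L2space leb (@measurable_circle R)).
Local Notation SK := (L2sip leb (@measurable_circle R) (@inv_two_pi_gt0 R)).
Local Notation H := (L2space P measurableT).
Local Notation SH := (L2sip P measurableT (@ltr01 R)).
Local Notation lift := (wlift leb (@measurable_circle R) phi).
Local Notation rv := (mkL2 P measurableT).
Implicit Types (g h A : R -> R[i]) (X Y zeta : T -> R[i]).

Lemma mseE X Y : randomL2 P X -> randomL2 P Y ->
  mse P X Y = (nrm2 SH (rv X - rv Y))%:E.
Proof. by move=> HX HY; rewrite nrm2_mkL2 // mul1e. Qed.

Lemma mse_ge0 X Y : (0 <= mse P X Y)%E.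
Proof.
by apply: integral_ge0 => t _; rewrite lee_fin mulr_ge0 ?sqmod_ge0.
Qed.

Lemma DeltaE A h : inL2f f A -> inL2f f h ->
  Delta A h f = (nrm2 SK (lift A - lift h))%:E.
Proof.
move=> HA Hh.
by rewrite (nrm2_wlift (mu := leb) mcirc (@inv_two_pi_gt0 R) mf mphi f_phi f_ge0 HA Hh).
Qed.

Lemma integral_sqmod_bounded g (C : R) : cmeasurable circle g -> 0 <= C ->
  (forall x, circle x -> sqmod (g x) <= C) ->
  (\int[leb]_(x in circle) (sqmod (g x) * f x)%:E <=
   C%:E * \int[leb]_(x in circle) (f x)%:E)%E.
Proof.
move=> mg C0 gC.
rewrite -ge0_integralZl_EFin //; [|exact: measurable_circle|exact/measurable_EFinP].
apply: ge0_le_integral; first exact: measurable_circle.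
- by move=> x cx; rewrite lee_fin mulr_ge0 ?sqmod_ge0 ?f_ge0.
- by apply/measurable_EFinP/measurable_funM => //; exact: measurable_sqmod.
- by apply/measurable_EFinP/measurable_funM => //; exact: measurable_cst.
- by move=> x cx; rewrite -EFinM lee_fin ler_wpM2r ?f_ge0 ?gC.
Qed.

Lemma inL2f_bounded g (C : R) : cmeasurable circle g ->
  (forall x, circle x -> sqmod (g x) <= C) -> inL2f f g.
Proof.
move=> mg gC; split => //.
have C0 : 0 <= C.
  apply: le_trans (sqmod_ge0 (g 0)) (gC 0 _).
  by rewrite /circle /= in_itv /= oppr_le0 !pi_ge0.
by apply: (le_lt_trans (integral_sqmod_bounded mg C0 gC)); exact: lte_mul_pinfty.
Qed.

Lemma cmeasurable_indic (B : set R) : borel_of_circle B ->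
  cmeasurable circle (fun x => (\1_B x)%:C : R[i]).
Proof. by move=> [mB _]; apply: cmeasurable_real; exact: measurable_indic. Qed.

Lemma inL2f_indic (B : set R) : borel_of_circle B ->
  inL2f f (fun x => (\1_B x)%:C).
Proof.
move=> HB; apply: (@inL2f_bounded _ 1); first exact: cmeasurable_indic.
by move=> x _; rewrite /sqmod /= indicE expr0n addr0; case: (_ \in _); rewrite ?expr1n ?expr0n.
Qed.

Lemma inL2f_expi (k : int) : inL2f f (fun x => expi (k%:~R * x)).
Proof.
apply: (@inL2f_bounded _ 1); first exact: cmeasurable_expi.
by move=> x _; rewrite sqmod_expi.
Qed.

(** The structure measure of [Z], read as an equality of Gram matrices; through [chull_pair_iso] it
    makes the stochastic integral isometric. *)
Lemma random_measure_gram (B C : set R) : borel_of_circle B -> borel_of_circle C ->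
  SH (rv (Z B)) (rv (Z C)) =
  SK (lift (fun x => (\1_B x)%:C)) (lift (fun x => (\1_C x)%:C)).
Proof.
move=> HB HC; case: Z_orthogonal => ZL2 _ ZE.
have mBC : measurable (B `&` C) by case: HB HC => mB _ [mC _]; exact: measurableI.
rewrite /= /L2ip (mkL2E measurableT (ZL2 B HB)) (mkL2E measurableT (ZL2 C HC)).
rewrite mul1r -/(E P _) ZE // rmorphM /=; congr (_ * _).
rewrite (wliftE (mu := leb) mcirc mf mphi f_phi f_ge0 (inL2f_indic HB)).
rewrite (wliftE (mu := leb) mcirc mf mphi f_phi f_ge0 (inL2f_indic HC)).
rewrite (_ : (fun x => _ * conjc _) =
    (fun x => (sqmod (phi x) * \1_(B `&` C) x)%:C)); last first.
  apply/funext => x; rewrite conjcM conjcr mulrACA mulcJ.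
  rewrite indicI /= !indicE; case: (x \in B); case: (x \in C) => /=;
    by rewrite ?(mulr0, mul0r, mulr1, mul1r).
rewrite /cint /= Rintegral_cst; last exact: measurable_circle.
rewrite mul0r; congr (_ +i* _).
have -> : B `&` C = circle `&` (B `&` C).
  by apply/esym/setIidPr => x [Bx _]; case: HB => _; apply.
rewrite Rintegral_mkcondr /Rintegral; congr fine.
have E : f \_ (B `&` C) = (fun x => f x * \1_(B `&` C) x).
  by apply/funext => x; rewrite patchE indicE; case: ifP => _; rewrite ?mulr1 ?mulr0.
rewrite E; have mi := measurable_indic (D := circle) mBC.
have -> : circle `&` (B `&` C) = B `&` C.
  by apply/setIidPr => x [Bx _]; case: HB => _; apply.
apply: ae_eq_integral; first exact: measurable_circle.
- by apply/measurable_EFinP/measurable_funM.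
- by apply/measurable_EFinP/measurable_funM => //; exact: measurable_sqmod.
- by apply: ae_weaken f_phi => x fx cx /=; rewrite fx.
Qed.

(** The graph of the stochastic integral on indicator functions; its hull is the graph of the whole
    integral. *)
Definition spectral_pair (B : set R) : (H * K)%type :=
  (rv (Z B), lift (fun x => (\1_B x)%:C)).
Local Notation spectral_hull := (chull (pair_sip SH SK) spectral_pair (@borel_of_circle R)).

Lemma borel_of_circle0 : borel_of_circle (set0 : set R).
Proof. by split; [exact: measurable0|exact: sub0set]. Qed.

(** A sequence of step functions approximating on both sides at once is the same as approximation of
    the pair in the direct sum. The sets in a step function may overlap, so arbitrary combinations
    of generators qualify. *)
Lemma stochastic_integralP h X : stochastic_integral P f Z h X <->
  [/\ inL2f f h, randomL2 P X & spectral_hull (rv X, lift h)].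
Proof.
have ZL2 B : borel_of_circle B -> randomL2 P (Z B) by case: Z_orthogonal => + _ _; apply.
have randS m (c : nat -> R[i]) (B : nat -> set R) : (forall i, borel_of_circle (B i)) ->
    randomL2 P (fun t => \sum_(i < m) c i * Z (B i) t).
  by move=> HB; apply: (inL2_sum measurableT) => i; apply: inL2Zp => //; exact: ZL2.
have fS m (c : nat -> R[i]) (B : nat -> set R) : (forall i, borel_of_circle (B i)) ->
    inL2f f (fun x => \sum_(i < m) c i * (\1_(B i) x)%:C).
  move=> HB; apply: (inL2w_sum (mu := leb) mcirc mf mphi f_phi f_ge0) => i.
  by apply: (inL2wZ (mu := leb) mcirc mf mphi f_phi f_ge0); exact: inL2f_indic.
have lcE m (c : nat -> R[i]) (B : nat -> set R) : (forall i, borel_of_circle (B i)) ->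
    (rv (fun t => \sum_(i < m) c i * Z (B i) t),
     lift (fun x => \sum_(i < m) c i * (\1_(B i) x)%:C)) =
    lincomb spectral_pair [seq (c i, B i) | i <- index_iota 0 m].
  move=> HB; rewrite [RHS]surjective_pairing lincomb_fst lincomb_snd.
  rewrite (mkL2_lincomb (mu := P) measurableT); last by move=> i; exact: ZL2.
  rewrite (wlift_lincomb (mu := leb) mcirc mf mphi f_phi f_ge0); last first.
    by move=> i; exact: inL2f_indic.
  by rewrite /lincomb !big_map !big_mkord.
split=> [[Hh HX [m [c [B [HB]]]]]|[Hh HX Hhull]].
  have nn1 n := sqdist_ge0 leb f_ge0 h
    (fun x => \sum_(i < m n) c n i * (\1_(B n i) x)%:C).
  have nn2 n := mse_ge0 X (fun t => \sum_(i < m n) c n i * Z (B n i) t).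
  move=> /(iffLR (ereal_cvg0P nn1)) H1 /(iffLR (ereal_cvg0P nn2)) H2.
  split=> // e e0; have e2 : 0 < e / 2 by lra.
  (* The factor [2 * pi] compensates the normalization of the seminorm on the circle. *)
  have [|N1 HN1] := H1 (e / 2 * (2 * pi)); first by rewrite mulr_gt0 ?two_pi_gt0.
  have [N2 HN2] := H2 _ e2.
  pose n := maxn N1 N2; exists [seq (c n i, B n i) | i <- index_iota 0 (m n)].
  split; first by rewrite all_map; apply/allP => i _ /=; exact: mem_set.
  rewrite -(lcE _ (c n) (B n)) // nrm2_pair /=.
  have L1 := HN1 n (leq_maxl _ _); have L2 := HN2 n (leq_maxr _ _).
  have SS := fS (m n) (c n) (B n) (HB n); have RS := randS (m n) (c n) (B n) (HB n).
  move: L1; rewrite (sqdist_lt (mu := leb) mcirc (@inv_two_pi_gt0 R) mf mphi f_phi f_ge0) //.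
  rewrite (mulrC _^-1) mulfK ?(lt0r_neq0 (@two_pi_gt0 R)) //.
  move: L2; rewrite mseE // lte_fin.
  have aux (x y : R) : x < e / 2 -> y < e / 2 -> x + y < e by lra.
  exact: aux.
have step n : exists l : seq (R[i] * set R),
    all (fun p => p.2 \in (@borel_of_circle R : set (set R))) l /\
    nrm2 (pair_sip SH SK) ((rv X, lift h) - lincomb spectral_pair l) < n.+1%:R^-1.
  by apply: Hhull; rewrite invr_gt0 ltr0Sn.
have [l Hl] := choice step.
(* The default set is empty, hence Borel, because [B n i] must be a Borel set of the circle for
   every [i], also past the end of the list. *)
pose c n i := (nth (0, set0) (l n) i).1; pose B n i := (nth (0, set0) (l n) i).2.
have HB n i : borel_of_circle (B n i).
  rewrite /B; have [il|li] := ltnP i (size (l n)).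
    by apply/set_mem/(allP (Hl n).1)/mem_nth.
  by rewrite nth_default //; exact: borel_of_circle0.
have lE n : [seq (c n i, B n i) | i <- index_iota 0 (size (l n))] = l n.
  rewrite -[RHS](mkseq_nth (0, set0)) /mkseq /index_iota subn0.
  by apply: eq_map => i; rewrite /c /B -surjective_pairing.
split=> //; exists (fun n => size (l n)), c, B.
have bound n : nrm2 SH (rv X - rv (fun t => \sum_(i < size (l n)) c n i * Z (B n i) t)) < n.+1%:R^-1
   /\ nrm2 SK (lift h - lift (fun x => \sum_(i < size (l n)) c n i * (\1_(B n i) x)%:C))
      < n.+1%:R^-1.
  have := (Hl n).2; rewrite -[X in lincomb _ X](lE n) -(lcE _ (c n) (B n)) // nrm2_pair /=.
  have aux (x y z : R) : 0 <= x -> 0 <= y -> x + y < z -> x < z /\ y < z by lra.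
  by apply: aux; exact: nrm2_ge0.
have small (e : R) : 0 < e -> exists N, forall n, (N <= n)%N -> n.+1%:R^-1 < e.
  move=> e0; exists (Num.truncn e^-1) => n Nn.
  rewrite invf_plt ?posrE ?ltr0Sn //; apply: (lt_le_trans (truncnS_gt _)).
  by rewrite ler_nat ltnS.
split=> //.
  apply/(sqdist_cvg0P (mu := leb) mcirc (@inv_two_pi_gt0 R) mf mphi f_phi f_ge0) => //.
    by move=> n; exact: fS.
  move=> e /small[N HN]; exists N => n /HN; apply: lt_trans; exact: (bound n).2.
apply/ereal_cvg0P => [n|]; first exact: mse_ge0.
move=> e /small[N HN]; exists N => n /HN; rewrite mseE //; last exact: randS.
by rewrite lte_fin; apply: lt_trans; exact: (bound n).1.
Qed.

Lemma spectral_hull_iso p q : spectral_hull p -> spectral_hull q ->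
  SH p.1 q.1 = SK p.2 q.2.
Proof. by move=> Hp Hq; exact: (chull_pair_iso random_measure_gram Hp Hq). Qed.

(** The difference of two points of the closed graph is again in it, and there the two seminorms
    coincide. *)
Lemma mse_Delta A h X zeta : stochastic_integral P f Z A X ->
  stochastic_integral P f Z h zeta -> mse P X zeta = Delta A h f.
Proof.
move=> /stochastic_integralP[HA HX hX] /stochastic_integralP[Hh Hz hz].
rewrite mseE // DeltaE //; congr (_%:E).
exact: (chull_pair_nrm2 random_measure_gram (chullB hX hz)).
Qed.

End StochasticIntegral.

Lemma cvgH_pair (R : realType) (V W : lmodType R[i]) (S : sip V) (S' : sip W)
    (u : nat -> V) (u' : nat -> W) x x' :
  cvgH S u x -> cvgH S' u' x' -> cvgH (pair_sip S S') (fun n => (u n, u' n)) (x, x').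
Proof.
move=> ux ux' e e0; have e2 : 0 < e / 2 by lra.
have [N HN] := ux _ e2; have [N' HN'] := ux' _ e2.
exists (maxn N N') => n; rewrite geq_max => /andP[/HN H /HN' H'].
rewrite nrm2_pair /=.
have aux (a b : R) : a < e / 2 -> b < e / 2 -> a + b < e by lra.
exact: aux.
Qed.

Lemma chull_pair_ext2 (R : realType) (V W : lmodType R[i]) (S : sip V) (S' : sip W)
    (I : Type) (u : I -> V * W) (J : set I) x y y' :
  nrm2 S' (y - y') = 0 ->
  chull (pair_sip S S') u J (x, y) -> chull (pair_sip S S') u J (x, y').
Proof. by move=> yy'; apply: chull_ext; rewrite nrm2_pair /= subrr nrm20 add0r. Qed.

(** * Transfer of hulls and limits along an isometry *)

Section IsometryTransfer.
Context {R : realType} {V W : lmodType R[i]} (S : sip V) (S' : sip W).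
Variables (I : Type) (u : I -> V) (u' : I -> W) (J : set I).
Hypothesis gram : forall i j, J i -> J j -> S (u i) (u j) = S' (u' i) (u' j).
Local Notation pairs := (fun i => (u i, u' i)).

Lemma pair_lincombE (I0 : Type) (v : I0 -> V) (v' : I0 -> W) l :
  lincomb (fun i => (v i, v' i)) l = (lincomb v l, lincomb v' l).
Proof. by rewrite [LHS]surjective_pairing lincomb_fst lincomb_snd. Qed.

(** The same coefficients approximate on both sides with the same error, since the pair of errors
    lies in the closed graph. *)
Lemma chull_pair_transfer (I0 : Type) (v : I0 -> V) (v' : I0 -> W) (J0 : set I0) x x' :
  (forall k, J0 k -> chull (pair_sip S S') pairs J (v k, v' k)) ->
  chull (pair_sip S S') pairs J (x, x') -> chull S v J0 x -> chull S' v' J0 x'.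
Proof.
move=> Hv Hx H e /H[l [Jl xl]]; exists l; split=> //.
have Hl : chull (pair_sip S S') pairs J ((x, x') - lincomb (fun i => (v i, v' i)) l).
  apply: chullB => //; apply: (chull_trans (u := fun i => (v i, v' i)) (J := J0)) => //.
  exact: chull_lincomb.
by have := chull_pair_nrm2 gram Hl; rewrite pair_lincombE /= => <-.
Qed.

Lemma cauchyH_transfer (p : nat -> V * W) :
  (forall n, chull (pair_sip S S') pairs J (p n)) ->
  cauchyH S' (fun n => (p n).2) -> cauchyH S (fun n => (p n).1).
Proof.
move=> Hp H e /H[N HN]; exists N => m n Nm Nn.
by have := chull_pair_nrm2 gram (chullB (Hp m) (Hp n)) => /= ->; exact: HN.
Qed.

(** Surjectivity of the isometry onto the hull of [u']: approximants of [y] are Cauchy, so are their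
    counterparts, and completeness of the first space supplies the limit. *)
Lemma chull_pair_lift (y : W) : completeH S -> chull S' u' J y ->
  exists x, chull (pair_sip S S') pairs J (x, y).
Proof.
move=> cS Hy.
have step n : exists l, all (fun p => p.2 \in J) l /\
    nrm2 S' (y - lincomb u' l) < n.+1%:R^-1.
  by apply: Hy; rewrite invr_gt0 ltr0Sn.
have [l Hl] := choice step; pose q n := lincomb pairs (l n).
have Hq n : chull (pair_sip S S') pairs J (q n) by apply: chull_lincomb; exact: (Hl n).1.
have yq : cvgH S' (fun n => (q n).2) y.
  move=> e e0; exists (Num.truncn e^-1) => n Nn; rewrite /q pair_lincombE /=.
  apply: (lt_le_trans (Hl n).2); apply: ltW.
  rewrite invf_plt ?posrE ?ltr0Sn //; apply: (lt_le_trans (truncnS_gt _)).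
  by rewrite ler_nat ltnS.
have [x Hx] := cS _ (cauchyH_transfer Hq (cvgH_cauchy yq)).
exists x; apply: (cvgH_chull (cvgH_pair Hx yq)) => n.
by rewrite -surjective_pairing.
Qed.

End IsometryTransfer.

Section L2AlmostEverywhere.
Context {R : realType} {d : measure_display} {T : measurableType d}.
Variables (mu : {measure set T -> \bar R}) (D : set T) (mD : measurable D).
Variables (kappa : R) (kappa_gt0 : 0 < kappa).
Local Notation S := (L2sip mu mD kappa_gt0).

Lemma inL2_ae (g h : T -> R[i]) : cmeasurable D g -> inL2 mu D (cst 1) h ->
  {ae mu, forall x, D x -> g x = h x} -> inL2 mu D (cst 1) g.
Proof.
move=> mg [mh ih] gh; split=> //; move: ih.
under eq_integral do rewrite mulr1; under [in X in _ -> X]eq_integral do rewrite mulr1.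
rewrite (_ : (\int[mu]_(x in D) (sqmod (h x))%:E)%E = (\int[mu]_(x in D) (sqmod (g x))%:E)%E) //.
apply: ae_eq_integral => //; try by apply/measurable_EFinP/measurable_sqmod.
by apply: ae_weaken gh => x gh Dx /=; rewrite gh.
Qed.

Lemma nrm2_ae0 (g h : L2space mu mD) :
  {ae mu, forall x, D x -> g x = h x} -> nrm2 S (g - h) = 0.
Proof.
move=> gh; have [mg _] := L2P g; have [mh _] := L2P h.
apply: EFin_inj; rewrite nrm2_L2.
rewrite (_ : (\int[mu]_(t in D) _)%E = 0%E) ?mule0 //.
rewrite -(integral0 mu D); apply: ae_eq_integral => //.
- by apply/measurable_EFinP/measurable_sqmod => //; exact: cmeasurableB.
- by apply: ae_weaken gh => x gh Dx; rewrite L2_subE gh // subrr sqmod0.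
Qed.

Lemma nrm2_L2_eq (g h : L2space mu mD) :
  (forall x, sqmod (g x) = sqmod (h x)) -> nrm2 S g = nrm2 S h.
Proof.
move=> gh; apply: EFin_inj; rewrite !nrm2_L2; congr (_ * _)%E.
by apply: eq_integral => x _; rewrite gh.
Qed.

Lemma mkL2Z c (g : T -> R[i]) : inL2 mu D (cst 1) g ->
  mkL2 mu mD (fun x => c * g x) = c *: mkL2 mu mD g.
Proof.
move=> Hg; have := mkL2_lincomb (mu := mu) mD [:: tt] (fun=> c) (F := fun=> g) (fun=> Hg).
by rewrite big_seq1 => <-; congr mkL2; apply/funext => x; rewrite big_seq1.
Qed.

Lemma mkL2_val (g : L2space mu mD) : mkL2 mu mD g = g.
Proof. by apply: val_inj; rewrite /= mkL2E //; exact: L2P. Qed.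

End L2AlmostEverywhere.

(** If the zero set of [f] had positive measure, the negative part of the logarithm, infinite there,
    would have infinite integral. *)
Lemma regular_neq0 (R : realType) (f : R -> R) :
  measurable_fun circle f -> (forall x, circle x -> 0 <= f x) -> regular f ->
  {ae (@lebesgue_measure R), forall x, circle x -> f x != 0}.
Proof.
move=> mf f0 reg; pose N := circle `&` [set x | f x = 0].
have mN : measurable N.
  rewrite (_ : N = circle `&` f @^-1` [set 0]) //.
  by apply: mf; [exact: measurable_circle|exact: measurable_set1].
exists N; split => //; last first.
  move=> x /= /not_implyP[cx /negP]; rewrite negbK => /eqP fx; split => //.
apply: contraPP reg => /eqP N0; rewrite /regular integralE.
(* [I] is the integral of the negative part. Once it is [+oo], the difference is [-oo] whatever the
   integral of the positive part is. *)
set I := (X in (_ - X)%E); suff -> : I = +oo%E by rewrite addeNy ltxx.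
apply/eqP; rewrite -leye_eq.
have -> : +oo%E = (\int[lebesgue_measure]_(x in N) (cst +oo%E x))%E.
  rewrite integral_cst //.
  by rewrite gt0_mulye // lt_neqAle eq_sym N0 measure_ge0.
apply: (@le_trans _ _ (\int[lebesgue_measure]_(x in N) (fun x => lne (f x)%:E)^\- x)%E).
  rewrite le_eqVlt; apply/orP; left; apply/eqP; apply: eq_integral => x /set_mem[_ /= fx].
  by rewrite funenegE fx lexx /= maxye.
apply: ge0_subset_integral => //.
- exact: measurable_circle.
- apply: measurable_funeneg; apply: (@eq_measurable_fun _ _ _ _ _
      (fun x => if f x == 0 then -oo%E else (ln (f x))%:E)).
    move=> x /set_mem cx; case: eqP => [->|/eqP fx]; first by rewrite le0_lneNy.
    by rewrite lne_EFin // lt_neqAle eq_sym fx f0.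
  apply: measurable_fun_if => //; first exact: measurable_circle.
  - by apply: measurable_fun_eqr => //; exact: measurable_cst.
  - apply/measurable_EFinP; apply: (@measurable_funS _ _ _ _ circle) => //.
      exact: measurable_circle.
    by apply: measurableT_comp => //; exact: measurable_ln.
- by move=> x [].
Qed.

(** * Absolutely convergent complex series *)

Section AbsolutelyConvergentSeries.
Context {R : realType}.

Lemma Re_le_cmod (z : R[i]) : `|complex.Re z| <= cmod z.
Proof. by rewrite -sqrtr_sqr /cmod ler_sqrt ?sqmod_ge0 // lerDl sqr_ge0. Qed.

Lemma Im_le_cmod (z : R[i]) : `|complex.Im z| <= cmod z.
Proof. by rewrite -sqrtr_sqr /cmod ler_sqrt ?sqmod_ge0 // lerDr sqr_ge0. Qed.

Lemma series_dominated (v b : nat -> R) : (forall j, `|v j| <= b j) ->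
  cvgn (series b) -> cvgn (series v) /\
  forall n, `|limn (series v) - series v n| <= limn (series b) - series b n.
Proof.
move=> vb cb; have b0 j : 0 <= b j by exact: le_trans (normr_ge0 _) (vb j).
have cv : cvgn (series v).
  by apply: normed_cvg; apply: series_le_cvg cb => // j; exact: normr_ge0.
split=> // n; have bL m : series b m <= limn (series b).
  by apply: nondecreasing_cvgn_le => //; apply: nondecreasing_series.
have key m : (n <= m)%N -> `|series v m - series v n| <= limn (series b) - series b n.
  move=> nm; apply: (@le_trans _ _ (series b m - series b n)); last by rewrite lerD2r.
  rewrite !sub_series nm; apply: (le_trans (ler_norm_sum _ _ _)).
  by apply: ler_sum => j _; exact: vb.
rewrite ler_distl; apply/andP; split.
  apply: limr_ge => //; exists n => // m /= /key; rewrite ler_distl => /andP[] //.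
apply: limr_le => //; exists n => // m /= /key; rewrite ler_distl => /andP[] //.
Qed.

(** The tail bound depends on [b] alone, hence is uniform in any parameter of [u]; the factor 2
    counts the real and the imaginary part. *)
Lemma csum_dominated (u : nat -> R[i]) (b : nat -> R) :
  (forall j, cmod (u j) <= b j) -> cvgn (series b) ->
  [/\ cvgn (series (fun j => complex.Re (u j))),
      cvgn (series (fun j => complex.Im (u j))) &
      forall n, sqmod (csum u - \sum_(j < n) u j) <=
                2 * (limn (series b) - series b n) ^+ 2].
Proof.
move=> ub cb.
have [cr Hr] := series_dominated (fun j => le_trans (Re_le_cmod (u j)) (ub j)) cb.
have [ci Hi] := series_dominated (fun j => le_trans (Im_le_cmod (u j)) (ub j)) cb.
split=> // n; rewrite /sqmod cReD cImD cReN cImN cRe_sum cIm_sum /csum /=.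
have := Hr n; have := Hi n; rewrite /series /= !big_mkord => hi hr.
rewrite -[X in X + _ <= _]real_normK ?num_real // -[X in _ + X <= _]real_normK ?num_real //.
have aux (p q t : R) : 0 <= p -> 0 <= q -> p <= t -> q <= t ->
  p ^+ 2 + q ^+ 2 <= 2 * t ^+ 2 by move=> *; nra.
exact: aux.
Qed.

Lemma cvgn_series_lty (b : nat -> R) : (forall j, 0 <= b j) ->
  (\sum_(0 <= j <oo) (b j)%:E < +oo)%E -> cvgn (series b).
Proof.
move=> b0 bfin; apply: nondecreasing_is_cvgn; first exact: nondecreasing_series.
exists (fine (\sum_(0 <= j <oo) (b j)%:E)%E) => _ [n _ <-].
rewrite -lee_fin fineK; last by rewrite ge0_fin_numE // nneseries_ge0 // => j _ _; rewrite lee_fin.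
rewrite /series /= -sumEFin; apply: nneseries_lim_ge => j _ _; by rewrite lee_fin.
Qed.

End AbsolutelyConvergentSeries.

(** * Prediction *)

Section Prediction.
Context {R : realType} {dT : measure_display} {T : measurableType dT}.
Variables (P : probability T R) (xi : int -> T -> R[i]) (f : R -> R).
Variables (Z : set R -> T -> R[i]) (d : nat -> R[i]) (phi : R -> R[i]).
Hypothesis xi_L2 : forall j, randomL2 P (xi j).
Hypothesis xi_density : spectral_density P xi f.
Hypothesis f_regular : regular f.
Hypothesis xi_spectral : spectral_representation P f Z xi.
Hypothesis f_canonical : canonical_factorization P xi f d phi.

Local Notation leb := (@lebesgue_measure R).
Local Notation mcirc := (@measurable_circle R).
Local Notation K := (L2space leb mcirc).
Local Notation SK := (L2sip leb mcirc (@inv_two_pi_gt0 R)).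
Local Notation H := (L2space P measurableT).
Local Notation SH := (L2sip P measurableT (@ltr01 R)).
Local Notation lift := (wlift leb mcirc phi).
Local Notation rv := (mkL2 P measurableT).
Local Notation expik k := (fun x : R => expi (k%:~R * x)).
Local Notation trig := (@trig R).

Let mf : measurable_fun circle f. Proof. by case: xi_density. Qed.
Let f_ge0 : forall x, circle x -> 0 <= f x. Proof. by case: xi_density. Qed.
Let f_int : (\int[leb]_(x in circle) (f x)%:E < +oo)%E.
Proof. by case: xi_density. Qed.
Let phiL2 : inL2 leb circle (cst 1) phi. Proof. by case: f_canonical => _ []. Qed.
Let mphi : cmeasurable circle phi. Proof. by case: phiL2. Qed.
Let f_phi : {ae leb, forall x, circle x -> f x = sqmod (phi x)}.
Proof. by case: f_canonical. Qed.
Let Z_orth : orthogonal_random_measure P f Z. Proof. by case: xi_spectral. Qed.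

Let phi_neq0 : {ae leb, forall x, circle x -> phi x != 0}.
Proof.
have f0 := regular_neq0 mf f_ge0 f_regular; apply: ae_weaken2 f_phi f0 => x E0 E1 cx.
by apply: contra (E1 cx) => /eqP px; rewrite E0 // px sqmod0.
Qed.

Local Notation Lexp := (inL2f_expi mf f_ge0 f_int).

Definition factor (k : int) : K := lift (expik k).

Lemma factorE k : factor k = (fun x => phi x * expi (k%:~R * x)) :> (R -> R[i]).
Proof. exact: (wliftE (mu := leb) mcirc mf mphi f_phi f_ge0 (Lexp k)). Qed.

Lemma factor_expansion (k : int) :
  cvgH SK (fun n => \sum_(u < n) d u *: trig (k - u%:Z)) (factor k).
Proof.
have expL2 (u : nat) : inL2 leb circle (cst 1) (fun x => d u * expi (- (u%:R * x))).
  have := inL2Zp (mu := leb) mcirc (d u) (inL2_expi (- u%:Z)).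
  by under eq_fun do rewrite mulrNz mulNr.
have [_ Hphi] := iffLR (L2_sum1P (mu := leb) mcirc (@inv_two_pi_gt0 R) _ expL2)
  (let: And4 _ phisum _ _ := f_canonical in phisum).
move=> e /Hphi[N HN]; exists N => n /HN; apply: le_lt_trans.
rewrite le_eqVlt; apply/orP; left; apply/eqP/nrm2_L2_eq => x.
rewrite !L2_subE factorE !L2_sumE (mkL2E (mu := leb) mcirc phiL2).
(* Multiplication by an exponential has modulus 1, so the expansion of [phi] carries over to every
   [factor k] with the same error. *)
set s := phi x - _; have -> : sqmod s = sqmod (s * expi (k%:~R * x)).
  by rewrite sqmodM sqmod_expi mulr1.
rewrite /s mulrBl mulr_suml; congr (sqmod (_ - _)); apply: eq_bigr => u _.
rewrite L2_scaleE trigE (mkL2E (mu := leb) mcirc (expL2 u)) -mulrA -expiD.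
congr (_ * expi _).
by rewrite rmorphB /= mulrBl addrC.
Qed.

Lemma observation_pair (k : int) : chull (pair_sip SH SK)
  (spectral_pair P Z phi) (@borel_of_circle R) (rv (xi k), factor k).
Proof.
case: xi_spectral => _ /(_ k).
by move=> /(stochastic_integralP mf f_ge0 f_int mphi f_phi Z_orth)[].
Qed.

Lemma observation_gram j k : SH (rv (xi j)) (rv (xi k)) = SK (factor j) (factor k).
Proof.
exact: (spectral_hull_iso mf f_ge0 f_int mphi f_phi Z_orth
         (observation_pair j) (observation_pair k)).
Qed.

(* Sending the innovation eps(m) to e^{im lambda} is isometric and sends xi(k)
   to phi e^{ik lambda}, so the innovation property carries over to the circle. *)
Lemma trig_innovation (m : int) : chull SK factor [set k | k <= m] (trig m).
Proof.
case: f_canonical => _ _ _ [eps [[epsL2 epsE] epsxi epsspan]].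
have gram i j : setT i -> setT j -> SH (rv (eps i)) (rv (eps j)) = SK (trig i) (trig j).
  move=> _ _; rewrite trig_orthonormal /= /L2ip.
  by rewrite (mkL2E measurableT (epsL2 i)) (mkL2E measurableT (epsL2 j)) mul1r -/(E P _) epsE.
pose hull := chull (pair_sip SH SK) (fun k => (rv (eps k), trig k)) setT.
have hxi k : hull (rv (xi k), factor k).
  have [_ Hxi] := iffLR (L2_sum1P measurableT (@ltr01 R) _
    (fun u => inL2Zp measurableT (d u) (epsL2 (k - u%:Z)))) (epsxi k).
  apply: (cvgH_chull (cvgH_pair Hxi (factor_expansion k))) => n.
  rewrite (_ : (_, _) = \sum_(u < n) d u *: (rv (eps (k - u%:Z)), trig (k - u%:Z))).
    by apply: chull_sum => u _; apply: chullZ; exact: chull_gen.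
  elim: n => [|n IH]; first by rewrite !big_ord0.
  rewrite !big_ord_recr /= -IH; congr (_ + _, _).
  exact: (mkL2Z measurableT _ (epsL2 _)).
have heps : hull (rv (eps m), trig m) by exact: chull_gen.
have : random_span P xi m (eps m).
  apply/epsspan; apply: (iffRL (closed_span1P measurableT (@ltr01 R) _ _ epsL2)).
  split; first exact: epsL2.
  by apply: (@chull_gen _ _ SH _ (fun k => rv (eps k)) _ m) => /=.
move=> /(closed_span1P measurableT (@ltr01 R) _ _ xi_L2)[_ Hm].
have Q := (@chull_pair_transfer _ _ _ SH SK _ _ _ _ gram _ (fun k => rv (xi k)) factor
  [set k | k <= m] _ _ (fun k _ => hxi k) heps Hm).
exact Q.
Qed.

(** The integral is obtained from exponentials rather than step functions: their integrals are the
    [xi k], so an approximation of [lift h] by factors lifts to random variables, and the limit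
    stays in the graph of the integral. *)
Lemma stochastic_integral_exists (h : R -> R[i]) : inL2f f h ->
  chull SK factor setT (lift h) -> exists zeta, stochastic_integral P f Z h zeta.
Proof.
move=> Hh hull.
have [zeta Hz] := chull_pair_lift (fun i j _ _ => observation_gram i j)
  (@L2_complete R _ _ P setT measurableT 1 (@ltr01 R)) hull.
exists zeta; apply/(stochastic_integralP mf f_ge0 f_int mphi f_phi Z_orth).
split => //; first exact: L2P.
by rewrite mkL2_val; apply: (chull_trans _ Hz) => k _; exact: observation_pair.
Qed.

(** Common core of the finite and the infinite problem, where only the projection series of phi A
    remains to be supplied. *)
Lemma optimal_estimate (X : T -> R[i]) (A r : R -> R[i]) :
  stochastic_integral P f Z A X -> chull SK factor setT (lift A) ->
  inL2 leb circle (cst 1) r ->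
  cvgH SK (fun n => \sum_(0 <= k < n) SK (lift A) (trig k%:Z) *: trig k%:Z)
    (mkL2 leb mcirc r) ->
  optimal_error_and_characteristic P f Z X A (nrm2 SK (mkL2 leb mcirc r))%:E
    (fun x => A x - (phi x)^-1 * r x).
Proof.
move=> XA hullA rL2 rproj; set h := (fun x => A x - _); set rr := mkL2 leb mcirc r.
have [AL2 XL2 _] := iffLR (stochastic_integralP mf f_ge0 f_int mphi f_phi Z_orth _ _) XA.
have wE := wliftE (mu := leb) mcirc mf mphi f_phi f_ge0.
have wP := inL2w (mu := leb) mcirc mf mphi f_phi f_ge0.
have [mA AphiL2] := iffLR (wP A) AL2.
have mh : cmeasurable circle h.
  apply: cmeasurableB => //; apply: cmeasurableM; last by case: rL2.
  exact: cmeasurableV.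
(* Where [phi] vanishes its inverse is 0 and the identity can fail; regularity confines this to a
   null set. *)
have hae : {ae leb, forall x, circle x -> phi x * h x = phi x * A x - r x}.
  by apply: ae_weaken phi_neq0 => x p0 cx; rewrite /h mulrBr mulVKf // p0.
have hL2 : inL2f f h.
  apply/wP; split => //.
  apply: (inL2_ae (mu := leb) mcirc _ _ hae); first exact: cmeasurableM.
  have -> : (fun x => phi x * A x - r x) = (fun x => phi x * A x + (-1) * r x).
    by apply/funext => x; rewrite mulN1r.
  by apply: (inL2Dp (mu := leb) mcirc) => //; exact: (inL2Zp (mu := leb) mcirc).
have hlift : nrm2 SK (lift A - rr - lift h) = 0.
  apply: nrm2_ae0; apply: ae_weaken hae => x hx cx.
  by rewrite L2_subE !wE // mkL2E // hx.
have minus g : L2minus f g <-> inL2f f g /\ chull SK factor [set k | k < 0] (lift g).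
  exact: (closed_spanP (mu := leb) mcirc (@inv_two_pi_gt0 R) mf mphi f_phi f_ge0 _ _ Lexp).
have sub_past := sub_proj_past (@trig_orthonormal R) factor_expansion trig_innovation hullA rproj.
have hminus : L2minus f h.
  by apply/minus; exact (conj hL2 (chull_ext hlift sub_past)).
(* Pythagoras, with [lift A - rr] replaced by [lift h], from which it differs by a null vector. *)
have DE g : L2minus f g -> Delta A g f = (nrm2 SK rr + nrm2 SK (lift h - lift g))%:E.
  move=> /minus[gL2 hullg].
  rewrite (DeltaE mf f_ge0 mphi f_phi AL2 gL2).
  rewrite (nrm2_sub_past (@trig_orthonormal R) factor_expansion trig_innovation hullA rproj hullg).
  congr ((_ + _)%:E).
  have -> : lift A - rr - lift g = (lift h - lift g) + (lift A - rr - lift h).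
    by rewrite [RHS]addrC addrA subrK.
  by rewrite nrm2D0.
have Dh : Delta A h f = (nrm2 SK rr)%:E by rewrite DE // subrr nrm20 addr0.
have Dmin g : L2minus f g -> ((nrm2 SK rr)%:E <= Delta A g f)%E.
  by move=> /DE ->; rewrite lee_fin lerDl nrm2_ge0.
have uniq g : L2minus f g -> (Delta A g f <= (nrm2 SK rr)%:E)%E ->
    sqdist leb circle f g h = 0%E.
  move=> Hg; rewrite (DE g Hg) lee_fin gerDl => H0.
  have {}H0 : nrm2 SK (lift h - lift g) = 0 by apply/le_anti; rewrite H0 nrm2_ge0.
  move/minus: Hg => [gL2 _].
  have := nrm2_wlift (mu := leb) mcirc (@inv_two_pi_gt0 R) mf mphi f_phi f_ge0 gL2 hL2.
  rewrite nrm2_subC H0 => /esym/eqP; rewrite mule_eq0 eqe gt_eqF ?inv_two_pi_gt0 //=.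
  by move=> /eqP.
have msD zeta g : spectral_characteristic P f Z zeta g -> mse P X zeta = Delta A g f.
  by move=> [_]; exact: (mse_Delta mf f_ge0 f_int mphi f_phi Z_orth XA).
have [zeta0 Hz0] := stochastic_integral_exists hL2
  (@chull_subset _ _ SK _ factor [set k | k < 0] setT _ (fun _ _ => Logic.I)
     (iffLR (minus h) hminus).2).
have sc0 : spectral_characteristic P f Z zeta0 h := conj hminus Hz0.
split => //.
  exists zeta0; split; first by exists h.
  move=> zeta' [g Hg]; rewrite (msD _ _ sc0) (msD _ _ Hg) Dh; apply: Dmin; exact: Hg.1.
move=> zeta [[g Hg] opt].
have le0 : (mse P X zeta <= (nrm2 SK rr)%:E)%E.
  by rewrite -Dh -(msD _ _ sc0); apply: opt; exists h.
have all0 g' : spectral_characteristic P f Z zeta g' -> sqdist leb circle f g' h = 0%E.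
  by move=> Hg'; apply: uniq; [exact: Hg'.1|rewrite -(msD _ _ Hg')].
split=> //.
  by apply/le_anti; rewrite le0 (msD _ _ Hg) Dmin //; exact: Hg.1.
split; first exact hminus.
apply/(stochastic_integralP mf f_ge0 f_int mphi f_phi Z_orth).
have [gL2 zL2 hullg] := iffLR (stochastic_integralP mf f_ge0 f_int mphi f_phi Z_orth _ _) Hg.2.
split; [exact hL2|exact zL2|].
(* The closed graph does not separate functions at distance zero, so [h] represents [zeta] as well
   as the characteristic [g] that came with it. *)
have gh0 : nrm2 SK (lift g - lift h) = 0; last exact (chull_pair_ext2 gh0 hullg).
apply: EFin_inj.
rewrite (nrm2_wlift (mu := leb) mcirc (@inv_two_pi_gt0 R) mf mphi f_phi f_ge0 gL2 hL2).
by rewrite all0 // mule0.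
Qed.

Lemma lift_sum n (a : nat -> R[i]) :
  lift (fun x => \sum_(j < n) a j * expi (j%:R * x)) = \sum_(j < n) a j *: factor j%:Z.
Proof.
exact: (wlift_lincomb (mu := leb) mcirc mf mphi f_phi f_ge0 (index_enum 'I_n)
  (fun j => a j) (F := fun j => expik (j : nat)%:Z) (fun j => Lexp (j : nat)%:Z)).
Qed.

Lemma inL2f_trig_sum n (a : nat -> R[i]) :
  inL2f f (fun x => \sum_(j < n) a j * expi (j%:R * x)).
Proof.
apply: (inL2w_sum (mu := leb) mcirc mf mphi f_phi f_ge0) => j.
exact: (inL2wZ (mu := leb) mcirc mf mphi f_phi f_ge0 (a j) (Lexp (j : nat)%:Z)).
Qed.

Lemma rv_sum n (a : nat -> R[i]) :
  rv (fun t => \sum_(j < n) a j * xi j%:Z t) = \sum_(j < n) a j *: rv (xi j%:Z).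
Proof.
exact: (mkL2_lincomb (mu := P) measurableT (index_enum 'I_n)
  (fun j => a j) (F := fun j => xi (j : nat)%:Z) (fun j => xi_L2 (j : nat)%:Z)).
Qed.

Lemma observation_sum_pair n (a : nat -> R[i]) :
  chull (pair_sip SH SK) (fun k => (rv (xi k), factor k)) setT
    (\sum_(j < n) a j *: rv (xi j%:Z), \sum_(j < n) a j *: factor j%:Z).
Proof.
have -> : (\sum_(j < n) a j *: rv (xi j%:Z), \sum_(j < n) a j *: factor j%:Z) =
    lincomb (fun k => (rv (xi k), factor k)) [seq (a j, j%:Z) | j <- index_iota 0 n].
  by rewrite pair_lincombE /lincomb !big_map !big_mkord.
by apply: chull_lincomb; apply/allP => q _; exact: mem_set.
Qed.

Lemma observation_sub x : chull (pair_sip SH SK) (fun k => (rv (xi k), factor k)) setT x ->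
  chull (pair_sip SH SK) (spectral_pair P Z phi) (@borel_of_circle R) x.
Proof. by apply: chull_trans => k _; exact: observation_pair. Qed.

(** * The transform of an absolutely summable sequence *)

Section AbsolutelySummable.
Variable a : nat -> R[i].
Hypothesis a_summable : (\sum_(0 <= j <oo) (cmod (a j))%:E < +oo)%E.

Let a_cvg : cvgn (series (fun j => cmod (a j))).
Proof. by apply: cvgn_series_lty => // j; exact: sqrtr_ge0. Qed.

Let dom x j : cmod (a j * expi (j%:R * x)) <= cmod (a j).
Proof. by rewrite /cmod sqmodM sqmod_expi mulr1. Qed.

Let tail n : R := limn (series (fun j => cmod (a j))) - series (fun j => cmod (a j)) n.

Lemma cmeasurable_Afun : cmeasurable circle (Afun a).
Proof.
have mS n : cmeasurable circle (fun x : R => \sum_(j < n) a j * expi (j%:R * x)).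
  by case: (inL2f_trig_sum n a).
split.
  apply: (@measurable_fun_cvg _ _ _ circle
    (fun n (x : R) => complex.Re (\sum_(j < n) a j * expi (j%:R * x)))) => [n|x _].
    by case: (mS n).
  have [c1 _ _] := csum_dominated (dom x) a_cvg.
  rewrite (_ : (fun n => _) = series (fun j => complex.Re (a j * expi (j%:R * x)))) //.
  by apply/funext => n; rewrite cRe_sum /series /= big_mkord.
apply: (@measurable_fun_cvg _ _ _ circle
  (fun n (x : R) => complex.Im (\sum_(j < n) a j * expi (j%:R * x)))) => [n|x _].
  by case: (mS n).
have [_ c2 _] := csum_dominated (dom x) a_cvg.
rewrite (_ : (fun n => _) = series (fun j => complex.Im (a j * expi (j%:R * x)))) //.
by apply/funext => n; rewrite cIm_sum /series /= big_mkord.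
Qed.

Lemma Afun_tail n x :
  sqmod (Afun a x - \sum_(j < n) a j * expi (j%:R * x)) <= 2 * tail n ^+ 2.
Proof. by have [_ _] := csum_dominated (dom x) a_cvg; apply. Qed.

Lemma inL2f_Afun : inL2f f (Afun a).
Proof.
apply: (inL2f_bounded mf f_ge0 f_int (C := 2 * tail 0 ^+ 2) cmeasurable_Afun) => x _.
by have := Afun_tail 0 x; rewrite big_ord0 subr0.
Qed.

Lemma tail_small (M e : R) : 0 <= M -> 0 < e ->
  exists N, forall n, (N <= n)%N -> tail n ^+ 2 * M < e.
Proof.
(* A tail below 1 dominates its own square, so a linear smallness condition is enough. *)
move=> M0 e0; have d0 : 0 < Num.min 1 (e / (M + 1)).
  by rewrite lt_min ltr01 divr_gt0 // ltr_wpDl.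
have [N _ HN] := (iffLR (cvgrPdist_lt _ _) a_cvg) _ d0.
exists N => n /HN; rewrite lt_min -/(tail n) => /andP[t1 tM].
have M1 : 0 < M + 1 by rewrite ltr_wpDl.
move: tM; rewrite ltr_pdivlMr // -(real_normK (num_real (tail n))).
move: (normr_ge0 (tail n)) t1; move: `|tail n| => t t0 t1 tM.
have tt : t ^+ 2 <= t by rewrite expr2; nra.
by apply: le_lt_trans tM; nra.
Qed.

(** Absolute summability gives uniform convergence on the circle, and the finite total mass of [f]
    turns it into convergence in L_2(f). *)
Lemma Afun_expansion :
  cvgH SK (fun n => \sum_(j < n) a j *: factor j%:Z) (lift (Afun a)).
Proof.
have finf : (\int[leb]_(x in circle) (f x)%:E)%E \is a fin_num.
  rewrite ge0_fin_numE //; apply: integral_ge0 => x cx; rewrite lee_fin; exact: f_ge0.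
pose F := fine (\int[leb]_(x in circle) (f x)%:E)%E.
have F0 : 0 <= F by apply/fine_ge0/integral_ge0 => x cx; rewrite lee_fin; exact: f_ge0.
have k0 : 0 < (2 * pi)^-1 :> R := inv_two_pi_gt0.
move=> e e0; have [|N HN] := tail_small (M := (2 * pi)^-1 * (2 * F)) _ e0.
  by rewrite !mulr_ge0 // ltW.
exists N => n /HN; apply: le_lt_trans; rewrite -lift_sum -lee_fin.
rewrite (nrm2_wlift (mu := leb) mcirc (@inv_two_pi_gt0 R) mf mphi f_phi f_ge0
  inL2f_Afun (inL2f_trig_sum n a)).
have mS : cmeasurable circle (fun x : R => \sum_(j < n) a j * expi (j%:R * x)).
  by case: (inL2f_trig_sum n a).
have t0 : 0 <= 2 * tail n ^+ 2 by rewrite mulr_ge0 // sqr_ge0.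
have H := integral_sqmod_bounded mf f_ge0 (cmeasurableB cmeasurable_Afun mS) t0
  (fun x _ => Afun_tail n x).
rewrite (_ : tail n ^+ 2 * _ = (2 * pi)^-1 * ((2 * tail n ^+ 2) * F)); last by ring.
rewrite EFinM; apply: lee_wpmul2l; first by rewrite lee_fin ltW.
by apply: (le_trans H); rewrite (EFinM (2 * tail n ^+ 2) F) /F fineK.
Qed.

Lemma Afun_hull : chull SK factor setT (lift (Afun a)).
Proof.
apply: (cvgH_chull Afun_expansion) => n; apply: chull_sum => j _.
by apply/chullZ/chull_gen.
Qed.

End AbsolutelySummable.

Let trig_nat (k : nat) : K := trig k%:Z.

Let trig_nat_ortho i j : SK (trig_nat i) (trig_nat j) = (i == j)%:R.
Proof. by rewrite /trig_nat trig_orthonormal. Qed.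

Let inL2_trig_sum n (c : nat -> R[i]) :
  inL2 leb circle (cst 1) (fun x => \sum_(k < n) c k * expi (k%:R * x)).
Proof.
apply: (inL2_sum (mu := leb) mcirc) => k.
exact: (inL2Zp (mu := leb) mcirc (c k) (inL2_expi (k : nat)%:Z)).
Qed.

Lemma mkL2_trig_sum n (c : nat -> R[i]) :
  mkL2 leb mcirc (fun x => \sum_(k < n) c k * expi (k%:R * x)) =
  \sum_(k < n) c k *: trig_nat k.
Proof.
exact: (mkL2_lincomb (mu := leb) mcirc (index_enum 'I_n)
  (fun k => c k) (F := fun k => expik (k : nat)%:Z) (fun k => inL2_expi (k : nat)%:Z)).
Qed.

Lemma is_rfunP (a : nat -> R[i]) (r : R -> R[i]) : is_rfun a d r <->
  inL2 leb circle (cst 1) r /\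
  cvgH SK (fun n => \sum_(k < n) Ad a d k *: trig_nat k) (mkL2 leb mcirc r).
Proof.
rewrite /is_rfun.
rewrite (L2_sum1P (mu := leb) mcirc (@inv_two_pi_gt0 R) r
  (fun k => inL2Zp (mu := leb) mcirc (Ad a d k) (inL2_expi k%:Z))).
have -> : (fun n => \sum_(k < n) mkL2 leb mcirc (fun x => Ad a d k * expi (k%:Z%:~R * x))) =
    (fun n => \sum_(k < n) Ad a d k *: trig_nat k); last by [].
apply/funext => n; apply: eq_bigr => k _.
exact: (mkL2Z (mu := leb) mcirc _ (inL2_expi (k : nat)%:Z)).
Qed.

Lemma prediction_finite (a : nat -> R[i]) (N : nat) :
  optimal_error_and_characteristic P f Z (AxiN N a xi) (AfunN N a)
    (\sum_(k < N.+1) (sqmod (AdN N a d k))%:E)%E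
    (fun x => AfunN N a x - (phi x)^-1 * rfunN N a d x).
Proof.
have liftA : lift (AfunN N a) = \sum_(j < N.+1) a j *: factor j%:Z := lift_sum N.+1 a.
have rvA : rv (AxiN N a xi) = \sum_(j < N.+1) a j *: rv (xi j%:Z) := rv_sum N.+1 a.
have rN : mkL2 leb mcirc (rfunN N a d) = \sum_(k < N.+1) AdN N a d k *: trig_nat k :=
  mkL2_trig_sum N.+1 (AdN N a d).
have ipA k : SK (lift (AfunN N a)) (trig_nat k) = \sum_(l < N.+1 - k) a (k + l)%N * d l.
  by rewrite liftA; exact (ip_finite_sum (@trig_orthonormal R) factor_expansion a N.+1 k).
have AX : stochastic_integral P f Z (AfunN N a) (AxiN N a xi).
  apply/(stochastic_integralP mf f_ge0 f_int mphi f_phi Z_orth); split.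
  - exact: inL2f_trig_sum.
  - apply: (inL2_sum (mu := P) measurableT) => j.
    exact: (inL2Zp (mu := P) measurableT (a j) (xi_L2 j%:Z)).
  - by rewrite rvA liftA; exact (observation_sub (observation_sum_pair N.+1 a)).
have hullA : chull SK factor setT (lift (AfunN N a)).
  by rewrite liftA; apply: chull_sum => j _; apply/chullZ/chull_gen.
have proj : cvgH SK (fun n => \sum_(0 <= k < n) SK (lift (AfunN N a)) (trig_nat k) *: trig_nat k)
    (mkL2 leb mcirc (rfunN N a d)).
  (* The coefficients beyond [N] vanish, so from [N.+1] terms on the partial projections equal the
     lifted [rfunN] exactly. *)
  move=> e e0; exists N.+1 => n Nn.
  rewrite (big_cat_nat (leq0n N.+1) Nn).
  rewrite [X in _ - (_ + X)]big_nat [X in _ - (_ + X)]big1; last first.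
    move=> k /andP[Nk _]; rewrite ipA (_ : (N.+1 - k = 0)%N); last lia.
    by rewrite big_ord0 scale0r.
  (* For [k <= N] one has [N.+1 - k = (N - k).+1], the summation bound in [AdN]. *)
  have E : \sum_(k < N.+1) SK (lift (AfunN N a)) (trig_nat k) *: trig_nat k =
           \sum_(k < N.+1) AdN N a d k *: trig_nat k.
    by apply: eq_bigr => k _; rewrite ipA /AdN subSn // -ltnS.
  by rewrite addr0 big_mkord E rN subrr nrm20.
have := optimal_estimate AX hullA (inL2_trig_sum N.+1 (AdN N a d)) proj.
rewrite -/(rfunN N a d) rN -(big_mkord xpredT (fun k => AdN N a d k *: trig_nat k)).
by rewrite (nrm2_sum_ortho _ _ _ trig_nat_ortho) big_mkord -sumEFin.
Qed.

Section Infinite.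
Variable a : nat -> R[i].
Hypothesis a_summable : (\sum_(0 <= j <oo) (cmod (a j))%:E < +oo)%E.

Let rv_cvgP (Axi : T -> R[i]) : ms_sum P (fun j t => a j * xi j%:Z t) Axi <->
  randomL2 P Axi /\ cvgH SH (fun n => \sum_(j < n) a j *: rv (xi j%:Z)) (rv Axi).
Proof.
rewrite /ms_sum (L2_sum1P (mu := P) measurableT (@ltr01 R) Axi
  (fun j => inL2Zp (mu := P) measurableT (a j) (xi_L2 j%:Z))).
have -> : (fun n => \sum_(j < n) rv (fun t => a j * xi j%:Z t)) =
    (fun n => \sum_(j < n) a j *: rv (xi j%:Z)); last by [].
apply/funext => n; apply: eq_bigr => j _.
exact: (mkL2Z (mu := P) measurableT _ (xi_L2 (j : nat)%:Z)).
Qed.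

(** The partial sums of A xi are isometric to those of phi A, which converge on the circle; no
    estimate of covariances is needed. *)
Lemma functional_exists : exists Axi, ms_sum P (fun j t => a j * xi j%:Z t) Axi.
Proof.
have cau := cauchyH_transfer (fun i j _ _ => observation_gram i j)
  (fun n => observation_sum_pair n a) (cvgH_cauchy (Afun_expansion a_summable)).
have [x Hx] := @L2_complete R _ _ P setT measurableT 1 (@ltr01 R) _ cau.
exists x; apply/rv_cvgP; rewrite mkL2_val; split; [exact: L2P|exact Hx].
Qed.

Let ip_Afun k : SK (lift (Afun a)) (trig_nat k) = Ad a d k.
Proof.
exact (ip_infinite_sum (@trig_orthonormal R) factor_expansion k (Afun_expansion a_summable)).
Qed.

Let proj_sumE : (fun n => \sum_(0 <= k < n) SK (lift (Afun a)) (trig_nat k) *: trig_nat k) =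
  (fun n => \sum_(k < n) Ad a d k *: trig_nat k).
Proof.
apply/funext => n; rewrite big_mkord; apply: eq_bigr => k _.
by rewrite ip_Afun.
Qed.

Lemma rfun_exists : exists r : R -> R[i], is_rfun a d r.
Proof.
have [r Hr] := proj_exists (@trig_orthonormal R) (lift (Afun a))
  (@L2_complete R _ _ leb circle mcirc _ (@inv_two_pi_gt0 R)).
exists r; apply/is_rfunP; rewrite mkL2_val; split; first exact: L2P.
by rewrite -proj_sumE; exact Hr.
Qed.

Lemma prediction_infinite (Axi : T -> R[i]) (r : R -> R[i]) :
  ms_sum P (fun j t => a j * xi j%:Z t) Axi -> is_rfun a d r ->
  optimal_error_and_characteristic P f Z Axi (Afun a) (l2norm2 (Ad a d))
    (fun x => Afun a x - (phi x)^-1 * r x).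
Proof.
move=> /rv_cvgP[AxiL2 Axi_cvg] /is_rfunP[rL2 r_cvg].
have AX : stochastic_integral P f Z (Afun a) Axi.
  apply/(stochastic_integralP mf f_ge0 f_int mphi f_phi Z_orth).
  split; [exact (inL2f_Afun a_summable)|exact AxiL2|].
  apply: observation_sub.
  apply: (cvgH_chull (cvgH_pair Axi_cvg (Afun_expansion a_summable))) => n.
  exact (observation_sum_pair n a).
rewrite -proj_sumE in r_cvg.
have lim : (fun n => \sum_(0 <= k < n) sqmod (Ad a d k)) @ \oo -->
    nrm2 SK (mkL2 leb mcirc r).
  have := nrm2_proj (@trig_orthonormal R) r_cvg.
  by under eq_fun do under eq_bigr do rewrite ip_Afun.
(* By Parseval the sums of squares converge to a real number, so the extended real sum is finite. *)
have -> : l2norm2 (Ad a d) = (nrm2 SK (mkL2 leb mcirc r))%:E.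
  apply/cvg_lim => //.
  under eq_fun do rewrite sumEFin.
  by apply: cvg_EFin => //; exact: nearW.
exact (optimal_estimate AX (Afun_hull a_summable) rL2 r_cvg).
Qed.

End Infinite.

End Prediction.

Theorem theorem10 (R : realType) (dT : measure_display) (T : measurableType dT)
    (P : probability T R) (xi : int -> T -> R[i]) (f : R -> R)
    (Z : set R -> T -> R[i]) (d : nat -> R[i]) (phi : R -> R[i])
    (a : nat -> R[i])
    (xi_stationary : zero_mean_wide_sense_stationary P xi)
    (xi_density : spectral_density P xi f)
    (f_regular : regular f)
    (xi_spectral : spectral_representation P f Z xi)
    (f_canonical : canonical_factorization P xi f d phi)
    (a_summable : (\sum_(0 <= j <oo) (cmod (a j))%:E < +oo)%E)
    (a_weighted :
      (\sum_(0 <= j <oo) (j.+1%:R * sqmod (a j))%:E < +oo)%E) :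
  [/\ exists Axi : T -> R[i], ms_sum P (fun j t => a j * xi j%:Z t) Axi,
      exists r : R -> R[i], is_rfun a d r,
      forall (Axi : T -> R[i]) (r : R -> R[i]),
        ms_sum P (fun j t => a j * xi j%:Z t) Axi ->
        is_rfun a d r ->
        optimal_error_and_characteristic P f Z Axi (Afun a)
          (l2norm2 (Ad a d))
          (fun x => Afun a x - (phi x)^-1 * r x) &
      forall N : nat,
        optimal_error_and_characteristic P f Z (AxiN N a xi) (AfunN N a)
          (\sum_(k < N.+1) (sqmod (AdN N a d k))%:E)%E
          (fun x => AfunN N a x - (phi x)^-1 * rfunN N a d x)].
Proof.
have [xi_L2 _ _] := xi_stationary.
split.
- exact (functional_exists xi_L2 xi_density xi_spectral f_canonical a_summable).
- exact (rfun_exists xi_density f_canonical a_summable).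
- exact (prediction_infinite xi_L2 xi_density f_regular xi_spectral
    f_canonical a_summable).
- move=> N; exact (prediction_finite xi_L2 xi_density f_regular xi_spectral f_canonical a N).
Qed.
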